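(* Let $d\ge 2$, let $D\subset\mathbb{R}^d$ be a bounded convex polygonal domain each of whose bounding hyperplanes has a Diophantine normal vector, with boundary $\Gamma=\partial D$. Let $A=(A^{ij})_{1\le i,j\le d}$ be a real matrix-valued function on $\mathbb{R}^d$ which is uniformly elliptic, i.e. there is a constant $c>0$ with $c^{-1}|\xi|^2\le A^{ij}(x)\xi_i\xi_j\le c|\xi|^2$ for all $x,\xi\in\mathbb{R}^d$, and let $g:\mathbb{R}^d\to\mathbb{C}$ be $\mathbb{Z}^d$-periodic. Assume $g$ and all entries of $A$ are sufficiently smooth. Let $\mathcal{L}u=-\mathrm{div}(A(x)\nabla u)$ and $\overline g=\int_{\mathbb{T}^d}g(y)\,dy$, where $\mathbb{T}^d$ is the unit torus. For a small parameter $\varepsilon>0$ let $u_\varepsilon$ be the solution of $\mathcal{L}u_\varepsilon=0$ in $D$, $u_\varepsilon(x)=g(x/\varepsilon)$ on $\Gamma$, and let $u_0$ be the solution of $\mathcal{L}u_0=0$ in $D$, $u_0=\overline g$ on $\Gamma$. Then for each $1\le p<\infty$ there exists a constant $C>0$ depending on $p$, $D$, $\mathcal{L}$, but independent of $\varepsilon$, such that $$\|u_\varepsilon-u_0\|_{L^p(D)}\ge C\,\varepsilon^{\frac1p}\,\|g-\overline g\|_{L^\infty(\mathbb{T}^d)}.$$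
   Context: A bounded convex polygonal domain is a bounded set $D=\bigcap_{j=1}^N\{x\in\mathbb{R}^d:\nu_j\cdot x>c_j\}$ with $c_j\in\mathbb{R}$ and unit vectors $\nu_j\in\mathbb{S}^{d-1}$. A vector $\nu\in\mathbb{R}^d$ is Diophantine if there exist $0<\tau(\nu)<\infty$ and a constant $C_\nu>0$ such that $|m\cdot\nu|>C_\nu|m|^{-\tau(\nu)}$ for all $m\in\mathbb{Z}^d\setminus\{0\}$, where $|m|=|m_1|+\dots+|m_d|$. Repeated indices are summed. The parameter $\varepsilon>0$ is understood to be small. The order of smoothness in ''sufficiently smooth'' is not specified in the statement.
   Formalization: The constant C and the smallness threshold for ε may also depend on g: replacing g by g(n·) turns the solution for ε into the one for ε/n while ‖g−ḡ‖_∞ is unchanged, so no C depending only on p, D and L can work. *)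

(* Defs.v *)
From HB Require Import structures.
From mathcomp Require Import all_boot all_order all_algebra.
From mathcomp Require Import all_classical all_reals all_analysis.
From mathcomp Require Import complex.
Import Order.TTheory GRing.Theory Num.Theory.
Import numFieldNormedType.Exports.

Set Implicit Arguments.
Unset Strict Implicit.
Unset Printing Implicit Defensive.

Local Open Scope classical_set_scope.
Local Open Scope ring_scope.

(* Lebesgue measure on R^n is built on the measurable type of n-tuples, by
   transporting the product measure through (x, t) |-> x :: t. *)
Section tuple_product_measure.
Context {R : realType} {n : nat}.
Local Notation RT := (measurableTypeR R).

Definition cons_pair (x : RT * n.-tuple RT) : n.+1.-tuple RT :=
  [tuple of x.1 :: x.2].

Definition uncons_pair (t : n.+1.-tuple RT) : RT * n.-tuple RT :=
  (thead t, [tuple of behead t]).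

Lemma measurable_cons_pair : measurable_fun setT cons_pair.
Proof. exact: measurable_cons measurable_fst measurable_snd. Qed.

Lemma measurable_uncons_pair : measurable_fun setT uncons_pair.
Proof.
apply: measurable_fun_pair; first exact: measurable_tnth.
exact: measurable_behead.
Qed.

Lemma cons_pairK : cancel cons_pair uncons_pair.
Proof. by case=> x t; rewrite /uncons_pair; congr pair; exact: val_inj. Qed.

Variable mu : {sigma_finite_measure set (n.-tuple RT) -> \bar R}.

Definition cons_measure : set (n.+1.-tuple RT) -> \bar R :=
  pushforward (product_measure1 (@lebesgue_measure R) mu) cons_pair.

Let cons_measure0 : cons_measure set0 = 0%E.
Proof. by rewrite /cons_measure /pushforward preimage_set0 measure0. Qed.

Let cons_measure_ge0 A : (0 <= cons_measure A)%E.
Proof. by rewrite /cons_measure /pushforward measure_ge0. Qed.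

Let cons_measure_sigma_additive : semi_sigma_additive cons_measure.
Proof.
move=> F mF tF mUF; rewrite /cons_measure /pushforward preimage_bigcup.
have mc A : measurable A -> measurable (cons_pair @^-1` A).
  by move=> mA; rewrite -[X in measurable X]setTI; exact: measurable_cons_pair.
apply: measure_semi_sigma_additive.
- by move=> k; exact: mc.
- apply/trivIsetP => /= i j _ _ ij; rewrite -preimage_setI.
  by move/trivIsetP : tF => /(_ _ _ _ _ ij) ->//; rewrite preimage_set0.
- by rewrite -preimage_bigcup; exact: mc.
Qed.

HB.instance Definition _ := isMeasure.Build _ _ _ cons_measure
  cons_measure0 cons_measure_ge0 cons_measure_sigma_additive.

Let cons_measure_sigma_finite : sigma_finite setT cons_measure.
Proof.
have /sigma_finiteP[F [TF ndF Foo]] := sigma_finiteT (@lebesgue_measure R).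
have /sigma_finiteP[G [TG ndG Goo]] := sigma_finiteT mu.
exists (fun k => uncons_pair @^-1` (F k `*` G k)).
  rewrite -preimage_bigcup (_ : \bigcup_k _ = setT) ?preimage_setT//.
  rewrite -subTset => -[x y] _.
  have [i _ Fix] : (\bigcup_i F i) x by rewrite -TF.
  have [j _ Gjy] : (\bigcup_i G i) y by rewrite -TG.
  exists (maxn i j) => //; split.
    by move: x Fix; exact/subsetPset/ndF/leq_maxl.
  by move: y Gjy; exact/subsetPset/ndG/leq_maxr.
move=> k; have [mF Fk] := Foo k; have [mG Gk] := Goo k; split.
  rewrite -[X in measurable X]setTI; apply: measurable_uncons_pair => //.
  exact: measurableX.
rewrite /cons_measure /pushforward -comp_preimage.
rewrite (_ : _ \o _ = id); last by apply/funext => x; exact: cons_pairK.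
by rewrite preimage_id product_measure1E// lte_mul_pinfty// ge0_fin_numE.
Qed.

HB.instance Definition _ := Measure_isSigmaFinite.Build _ _ _ cons_measure
  cons_measure_sigma_finite.

End tuple_product_measure.

Fixpoint lebesgue_tuple (R : realType) (n : nat) :
    {sigma_finite_measure set (n.-tuple (measurableTypeR R)) -> \bar R} :=
  match n with
  | 0 => [the {sigma_finite_measure set _ -> \bar R} of dirac [tuple]]
  | n'.+1 => [the {sigma_finite_measure set _ -> \bar R} of
                cons_measure (lebesgue_tuple R n')]
  end.

Section definitions.
Context {R : realType} {d : nat}.
Implicit Types (x y : 'rV[R]_d) (U D : set 'rV[R]_d) (h : 'rV[R]_d -> R[i]).

Definition row_of_tuple (t : d.-tuple (measurableTypeR R)) : 'rV[R]_d :=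
  \row_i tnth t i.

(* L^p(U) norm as the L^p(R^d) norm of the zero extension; also right for
   p = +oo, since the modulus is nonnegative. *)
Definition Lpnorm (p : \bar R) U h : \bar R :=
  Lnorm (lebesgue_tuple R d) p
    (fun t => ((fun x => (ComplexField.Normc.normc (h x))%:E) \_ U)
                (row_of_tuple t)).

Definition integral_rV U (f : 'rV[R]_d -> R) : R :=
  Rintegral (lebesgue_tuple R d) (row_of_tuple @^-1` U) (f \o row_of_tuple).

Definition cintegral_rV U h : R[i] :=
  Complex (integral_rV U (fun x => complex.Re (h x)))
          (integral_rV U (fun x => complex.Im (h x))).

(* Fundamental cell of the torus R^d / Z^d: functions on the torus are
   Z^d-periodic functions, integrated and normed over this cell. *)
Definition unit_cell : set 'rV[R]_d := [set x | forall i, 0 <= x 0 i < 1].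

Definition dotmul x y : R := \sum_i x 0 i * y 0 i.

Definition unit_vector x : Prop := dotmul x x = 1.

Definition diophantine (nu : 'rV[R]_d) : Prop :=
  exists tau C : R, [/\ 0 < tau, 0 < C &
    forall m : 'rV[int]_d, m != 0 ->
      C * (\sum_i `|(m 0 i)%:~R : R|) `^ (- tau) <
      `|dotmul (map_mx intr m) nu| ].

Definition polygon N (nu : 'I_N -> 'rV[R]_d) (c : 'I_N -> R) : set 'rV[R]_d :=
  [set x | forall j, c j < dotmul (nu j) x].

(* The representation is existential, so redundant half-spaces impose nothing on
   D; non-emptiness is part of D being a domain. *)
Definition diophantine_polygonal_domain D : Prop :=
  exists N (nu : 'I_N -> 'rV[R]_d) (c : 'I_N -> R),
    [/\ forall j, unit_vector (nu j),
        forall j, diophantine (nu j),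
        D = polygon nu c,
        D !=set0 &
        bounded_set D].

Definition boundary D : set 'rV[R]_d := closure D `\` interior D.

Definition basis_vector (i : 'I_d) : 'rV[R]_d := delta_mx 0 i.

(* Meaningful for U open. *)
Fixpoint Ck (k : nat) U (f : 'rV[R]_d -> R) : Prop :=
  (forall x, U x -> {for x, continuous f}) /\
  match k with
  | 0 => True
  | k'.+1 => forall i : 'I_d,
      (forall x, U x -> derivable f x (basis_vector i)) /\
      Ck k' U (fun x => 'D_(basis_vector i) f x)
  end.

(* A property of a complex-valued function, through its real and imaginary
   parts. *)
Definition ReIm (P : ('rV[R]_d -> R) -> Prop) h : Prop :=
  P (fun x => complex.Re (h x)) /\ P (fun x => complex.Im (h x)).

Definition uniformly_elliptic (A : 'rV[R]_d -> 'M[R]_d) : Prop :=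
  exists c : R, 0 < c /\ forall x (xi : 'rV[R]_d),
    c^-1 * dotmul xi xi <= \sum_i \sum_j A x i j * xi 0 i * xi 0 j
                        <= c * dotmul xi xi.

Definition Zperiodic h : Prop :=
  forall x (m : 'rV[int]_d), h (x + map_mx intr m) = h x.

Definition divform (A : 'rV[R]_d -> 'M[R]_d) (v : 'rV[R]_d -> R) x : R :=
  - \sum_i 'D_(basis_vector i)
      (fun y => \sum_j A y i j * 'D_(basis_vector j) v y) x.

(* Classical solution: C^2 inside, continuous up to the boundary. Only the
   values of u on the closure of D matter. *)
Definition dirichlet_solution (A : 'rV[R]_d -> 'M[R]_d) D
    (phi u : 'rV[R]_d -> R[i]) : Prop :=
  [/\ ReIm (Ck 2 D) u,
      ReIm (fun v => {within closure D, continuous v}) u,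
      ReIm (fun v => forall x, D x -> divform A v x = 0) u &
      forall x, boundary D x -> u x = phi x].

End definitions.

(* Main.v *)
Require Import Defs.
From HB Require Import structures.
From mathcomp Require Import all_boot all_order all_algebra.
From mathcomp Require Import all_classical all_reals all_analysis.
From mathcomp Require Import complex measurable_realfun ess_sup_inf.
From mathcomp Require Import ring lra.
Import Order.TTheory GRing.Theory Num.Theory.
Import numFieldNormedType.Exports.

Set Implicit Arguments.
Unset Strict Implicit.
Unset Printing Implicit Defensive.

Local Open Scope classical_set_scope.
Local Open Scope ring_scope.

(* Since [C] may depend on [g], it suffices to find a set of measure of order
   [eps] on which [u_eps - u_0] stays away from 0; if [g] is not identically
   [gbar], one of the functions +-Re (g - gbar), +-Im (g - gbar) is positive at
   some point [y], so the problem becomes real and one-sided.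

   Take a genuine face of [D], with normal [nu]. The integer combinations of
   the entries of [nu] are nonzero, hence arbitrarily small, so every translate
   of the hyperplane orthogonal to [nu] comes close to [y + Z^d] within a
   bounded distance of any of its points. After scaling by [eps], the face
   contains about [eps^-(d-1)] well separated points [p] near which the boundary
   data are bounded below by a positive constant.

   On the strip of [D] of width [eps] along the face, the function
     2 delta - K |x - p|^2 / eps^2 - M' (1 - exp (- l s / eps)),
   with [s] the distance to the face, is a strict subsolution lying below the
   boundary values, so by the maximum principle the solution is at least
   [delta] on [D] within [r0 eps] of [p]. There [D] contains a cube of side of
   order [eps]; these cubes are disjoint and their total volume is of order
   [eps^-(d-1) * eps^d = eps]. *)

Section directional_calculus.
Context {R : realType} {V : normedModType R}.
Implicit Types (f : V -> R) (x u v : V).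

Lemma is_derive_line f x v (t df : R) :
  is_derive (x + t *: v) v f df -> is_derive t 1 (fun s => f (x + s *: v)) df.
Proof.
have E : (fun h : R => h^-1 *: ((f \o shift (x + t *: v)) (h *: v) - f (x + t *: v)))
   = (fun h : R =>
      h^-1 *: (((fun s => f (x + s *: v)) \o shift t) (h *: (1 : R)) - f (x + t *: v))).
  apply/funext => h /=; congr (_ *: (f _ - _)).
  by rewrite [h *: 1]mulr1 scalerDl addrCA.
by case; rewrite /derivable /derive E => d1 d2; split.
Qed.

Lemma is_derive_line0 f x v (df : R) :
  is_derive (0 : R) 1 (fun s => f (x + s *: v)) df -> is_derive x v f df.
Proof.
have E : (fun h : R => h^-1 *: ((f \o shift x) (h *: v) - f x))
   = (fun h : R =>
      h^-1 *: (((fun s => f (x + s *: v)) \o shift 0) (h *: (1 : R)) - f (x + 0 *: v))).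
  apply/funext => h /=; congr (_ *: (f _ - _)).
    by rewrite [h *: 1]mulr1 addr0 addrC.
  by rewrite scale0r addr0.
by case; rewrite /derivable /derive -E => d1 d2; split.
Qed.

Lemma is_deriveZdir f x v (c df : R) :
  is_derive x v f df -> is_derive x (c *: v) f (c * df).
Proof.
move=> fv; apply: is_derive_line0.
have -> : (fun s : R => f (x + s *: (c *: v))) =
    (fun s => f (x + s *: v)) \o (fun s => s * c).
  by apply/funext => s /=; rewrite scalerA.
rewrite mulrC; apply: is_derive1_comp.
  by apply: is_derive_line; rewrite mul0r scale0r addr0.
by apply: is_derive_eq; rewrite scaler0 add0r [_ *: _]mulr1.
Qed.

Lemma line_MVT f (df : V -> R) x v (s : R) : 0 < s ->
  (forall t, 0 <= t <= s -> is_derive (x + t *: v) v f (df (x + t *: v))) ->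
  exists2 c, 0 < c < s & f (x + s *: v) - f x = s * df (x + c *: v).
Proof.
move=> s0 fd.
have fd' t : 0 <= t <= s ->
    is_derive t 1 (fun s => f (x + s *: v)) (df (x + t *: v)).
  by move=> /fd; exact: is_derive_line.
have [||c] := @MVT R (fun s => f (x + s *: v)) (fun t => df (x + t *: v)) 0 s s0.
- move=> t; rewrite in_itv/= => /andP[t0 ts]; apply: fd'.
  by rewrite !ltW.
- apply: derivable_within_continuous => t; rewrite in_itv/= => /fd' ?.
  exact: ex_derive.
rewrite in_itv/= => c0s; rewrite scale0r addr0 subr0 => ->.
by exists c => //; rewrite mulrC.
Qed.

Lemma line_MVT_abs f (df : V -> R) x v (s : R) :
  (forall t, `|t| <= `|s| -> is_derive (x + t *: v) v f (df (x + t *: v))) ->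
  exists2 c, `|c| <= `|s| & f (x + s *: v) - f x = s * df (x + c *: v).
Proof.
case: ltrgt0P => [s0|s0|->] fd.
- have [|c /andP[c0 cs] E] := @line_MVT f df x v s s0.
    by move=> t /andP[t0 ts]; apply: fd; rewrite ger0_norm.
  by exists c => //; rewrite gtr0_norm// ltW.
- have [||c /andP[c0 cs] E] := @line_MVT f (- df) x (- v) (- s).
  + by rewrite oppr_gt0.
  + move=> t /andP[t0 ts]; rewrite scalerN -scaleNr.
    have := is_deriveZdir (-1) (fd (- t) _).
    by rewrite scaleN1r mulN1r; apply; rewrite normrN ger0_norm.
  + exists (- c); first by rewrite normrN gtr0_norm// ltW.
    by move: E; rewrite scalerN scaleNr opprK mulrNN scalerN -scaleNr.
- by exists 0; [rewrite normr0|rewrite scale0r addr0 subrr mul0r].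
Qed.

(* Only [D_u f] needs to exist nearby: the increment along [u + v] is split at
   [x + t v], and the [u]-part is handled by the mean value theorem. *)
Lemma is_derive_add_dir f (df : V -> R) x u v (dv : R) :
  (\near x, is_derive x u f (df x)) -> {for x, continuous df} ->
  is_derive x v f dv -> is_derive x (u + v) f (df x + dv).
Proof.
move=> fu cdf fv; apply: is_derive_line0.
suff H : (fun h : R => h^-1 *: (((fun s => f (x + s *: (u + v))) \o shift 0)
    (h *: (1 : R)) - f (x + 0 *: (u + v)))) @ 0^' --> df x + dv.
  by split; [apply/cvg_ex; exists (df x + dv)|exact: cvg_lim].
have fvl : (fun h : R => h^-1 * (f (x + h *: v) - f x)) @ 0^' --> dv.
  case: fv => [cv <-]; rewrite /derive.
  rewrite (_ : (fun h : R => _) =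
     (fun h => h^-1 *: ((f \o shift x) (h *: v) - f x)))//.
  by apply/funext => h /=; rewrite [x + _]addrC.
rewrite (_ : (fun h : R => _) = (fun h =>
   (h^-1 * (f (x + h *: v + h *: u) - f (x + h *: v))) +
   (h^-1 * (f (x + h *: v) - f x)))); last first.
  apply/funext => h /=.
  rewrite scale0r !addr0 [h *: (1 : R)]mulr1 -mulrDr subrKA [h *: (u + v)]scalerDr.
  by congr (_ * (f _ - _)); rewrite -addrA [h *: v + _]addrC.
apply: cvgD fvl; apply/cvgrPdist_lt => e e0.
have cdfe : \forall y \near x, `|df x - df y| < e.
  by move: cdf => /cvgrPdist_lt /(_ _ e0).
have /nbhs_ballP[r /= r0 xr] : \forall y \near x,
    is_derive y u f (df y) /\ `|df x - df y| < e.
  exact: filterI fu cdfe.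
have k0 : 0 < `|u| + `|v| + 1 by rewrite ltr_pwDr// addr_ge0.
near=> h.
have h0 : h != 0 by near: h; exact: nbhs_dnbhs_neq.
have hr : `|h| * (`|u| + `|v| + 1) < r.
  rewrite -ltr_pdivlMr//; near: h; apply: dnbhs0_lt; exact: divr_gt0.
have hy t : `|t| <= `|h| -> ball x r (x + h *: v + t *: u).
  move=> th; rewrite -ball_normE/= -addrA opprD addNKr normrN.
  rewrite (le_lt_trans (ler_normD _ _))// !normrZ (le_lt_trans _ hr)//.
  rewrite -addrA mulrDr mulrDr addrCA lerD2l mulr1.
  by rewrite ler_wpDr// ler_wpM2r.
have [|c ch ->] := @line_MVT_abs f df (x + h *: v) u h.
  by move=> t th; have [] := xr _ (hy _ th).
by rewrite mulKf//; have [] := xr _ (hy _ ch).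
Unshelve. all: by end_near. Qed.

End directional_calculus.

Section mixed_derivatives.
Context {R : realType} {V : normedModType R}.
Implicit Types (f : V -> R) (x u v : V).

Lemma is_derive_translate f x u w (df : R) :
  is_derive (x + w) u f df -> is_derive x u (fun y => f (y + w)) df.
Proof.
have E : (fun h : R => h^-1 *: ((f \o shift (x + w)) (h *: u) - f (x + w)))
   = (fun h : R => h^-1 *: (((fun y => f (y + w)) \o shift x) (h *: u) - f (x + w))).
  by apply/funext => h /=; rewrite addrA.
by case; rewrite /derivable /derive E => d1 d2; split.
Qed.

Lemma open_line (U : set V) x v : open U -> U x ->
  exists2 r : R, 0 < r & forall t, `|t| <= r -> U (x + t *: v).
Proof.
move=> oU Ux; have /nbhs_ballP[r /= r0 xr] := open_nbhs_nbhs (conj oU Ux).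
have v1 : 0 < `|v| + 1 by rewrite ltr_pwDr.
exists (r / (`|v| + 1) / 2) => [|t tr]; first by rewrite !divr_gt0.
apply: xr; rewrite -ball_normE/= opprD addNKr normrN normrZ.
rewrite (@le_lt_trans _ _ (`|t| * (`|v| + 1)))//.
  by rewrite ler_wpM2l// lerDl.
rewrite -ltr_pdivlMr// (le_lt_trans tr)//.
by rewrite ltr_pdivrMr// ltr_pMr ?divr_gt0// ltr1n.
Qed.

Lemma mixed_MVT f (fu fuv : V -> R) x u v (s : R) : 0 < s ->
  (forall a b, 0 <= a <= s -> 0 <= b <= s ->
    is_derive (x + a *: u + b *: v) u f (fu (x + a *: u + b *: v)) /\
    is_derive (x + a *: u + b *: v) v fu (fuv (x + a *: u + b *: v))) ->
  exists a b, [/\ 0 < a < s, 0 < b < s &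
    (f (x + s *: u + s *: v) - f (x + s *: u)) - (f (x + s *: v) - f x) =
    s * (s * fuv (x + a *: u + b *: v))].
Proof.
move=> s0 fd.
have ss : 0 <= s <= s by rewrite lexx ltW.
have s00 : (0 : R) <= 0 <= s by rewrite lexx ltW.
have [|a a0s E] := @line_MVT R V (fun y => f (y + s *: v) - f y)
    (fun y => fu (y + s *: v) - fu y) x u s s0.
  move=> t t0s; apply: is_deriveB.
    by apply: is_derive_translate; have [] := fd t s t0s ss.
  by have [+ _] := fd t 0 t0s s00; rewrite scale0r addr0.
have a0s' : 0 <= a <= s by case/andP : a0s => /ltW -> /ltW ->.
have [|b b0s E'] := @line_MVT R V fu fuv (x + a *: u) v s s0.
  by move=> t t0s; have [] := fd a t a0s' t0s.
by exists a, b; split => //; rewrite E E'.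
Qed.

Lemma local_max_derive_eq0 (U : set V) f (df : V -> R) x v : open U -> U x ->
  (forall y, U y -> is_derive y v f (df y)) -> (forall y, U y -> f y <= f x) ->
  df x = 0.
Proof.
move=> oU Ux fd fmax; have [r r0 xr] := open_line v oU Ux.
have fd' (t : R) : `|t| <= r -> is_derive t 1 (fun s => f (x + s *: v)) (df (x + t *: v)).
  by move=> /xr /fd; exact: is_derive_line.
have [||||] := @derive1_at_max R (fun s => f (x + s *: v)) (- r) r 0.
- by rewrite lerNl (le_trans _ (ltW r0))// oppr_le0 ltW.
- move=> t; rewrite in_itv/= => /andP[t0 t1]; apply: ex_derive; apply: fd'.
  by rewrite ler_norml !ltW.
- by rewrite in_itv/= r0 oppr_lt0 r0.
- move=> t; rewrite in_itv/= => /andP[t0 t1]; rewrite scale0r addr0.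
  by apply/fmax/xr; rewrite ler_norml !ltW.
move=> _ <-; have := fd' 0; rewrite normr0 scale0r addr0 => /(_ (ltW r0)).
by move=> fd0; rewrite derive_val.
Qed.

Lemma local_max_derive2_le0 (U : set V) f (df : V -> R) x v (q : R) :
  open U -> U x ->
  (forall y, U y -> is_derive y v f (df y)) -> (forall y, U y -> f y <= f x) ->
  is_derive x v df q -> q <= 0.
Proof.
move=> oU Ux fd fmax [dd dq].
have df0 := local_max_derive_eq0 oU Ux fd fmax.
rewrite leNgt; apply/negP => q0; move: dd dq; rewrite /derivable /derive df0.
move=> /[swap] dq /cvgP; rewrite dq => /cvgr_gt/(_ _ q0) near_pos.
have [r r0 xr] := open_line v oU Ux.
have /nbhs_ballP[r' /= r'0 xr'] := near_pos.
pose s := Num.min r r' / 2.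
have mrr : 0 < Num.min r r' by rewrite lt_min r0.
have s0 : 0 < s by rewrite divr_gt0.
have srr : s < Num.min r r' by rewrite ltr_pdivrMr// ltr_pMr// ltr1n.
have [sr sr'] : s < r /\ s < r' by move: srr; rewrite lt_min => /andP[].
have [|c /andP[c0 cs] E] := @line_MVT R V f df x v s s0.
  by move=> t /andP[t0 ts]; apply/fd/xr; rewrite ger0_norm// (le_trans ts)// ltW.
have : f (x + s *: v) <= f x by apply/fmax/xr; rewrite gtr0_norm// ltW.
rewrite -subr_le0 E pmulr_rle0// leNgt => /negP; apply.
have := xr' c; rewrite -ball_normE/= sub0r normrN gtr0_norm// => /(_ (lt_trans cs sr')).
move=> /(_ (lt0r_neq0 c0)); rewrite subr0 addrC => /=.
by rewrite pmulr_rgt0// invr_gt0.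
Qed.

End mixed_derivatives.

Section psd_pairing.
Context {R : realFieldType} {n : nat}.
Implicit Types (A H : 'M[R]_n) (x : 'rV[R]_n).

Definition qform A x : R := \sum_i \sum_j A i j * x 0 i * x 0 j.

Lemma sum_pick (F : 'I_n -> R) k : \sum_i F i * (i == k)%:R = F k.
Proof.
rewrite (bigD1 k)//= eqxx mulr1 big1 ?addr0// => i /negbTE ->.
by rewrite mulr0.
Qed.

Lemma qform_delta A k : qform A (delta_mx 0 k) = A k k.
Proof.
rewrite /qform -[RHS](sum_pick (fun i => A i k)); apply: eq_bigr => i _.
under eq_bigr do rewrite !mxE !eqxx/=.
by rewrite (sum_pick (fun j => A i j * (i == k)%:R)).
Qed.

Lemma qformD_delta H x t k : H^T = H ->
  qform H (x + t *: delta_mx 0 k) =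
  qform H x + t * (\sum_j H k j * x 0 j) *+ 2 + t ^+ 2 * H k k.
Proof.
move=> symH; pose f j := \sum_i H i j * x 0 i.
have fE j : f j = \sum_i H j i * x 0 i.
  by apply: eq_bigr => i _; rewrite -{1}symH mxE.
transitivity (\sum_j (x 0 j + t * (j == k)%:R) * (f j + t * H k j)).
  rewrite /qform exchange_big; apply: eq_bigr => j _ /=.
  rewrite -[H k j](sum_pick (fun i => H i j)) mulr_sumr -big_split mulr_sumr.
  apply: eq_bigr => i _; rewrite !mxE/=.
  by rewrite -mulrA mulrC; ring.
rewrite -fE.
transitivity (\sum_j x 0 j * f j + t * (\sum_j H k j * x 0 j)
   + t * (\sum_j f j * (j == k)%:R) + t ^+ 2 * \sum_j H k j * (j == k)%:R).
  rewrite !mulr_sumr -!big_split; apply: eq_bigr => j _ /=; ring.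
rewrite !sum_pick -fE mulr2n -!addrA; congr (_ + _).
rewrite /qform exchange_big; apply: eq_bigr => j _ /=; rewrite mulr_sumr.
by apply: eq_bigr => i _; ring.
Qed.

(* Lagrange's reduction: completing the square in one variable at a time. *)
Lemma psd_sum_squares H : H^T = H -> (forall x, 0 <= qform H x) ->
  exists s : seq (R * 'rV[R]_n), (forall p, p \in s -> 0 <= p.1) /\
    forall i j, H i j = \sum_(p <- s) p.1 * p.2 0 i * p.2 0 j.
Proof.
move=> symH psdH.
suff Hk (k : nat) : (k <= n)%N -> forall H, H^T = H -> (forall x, 0 <= qform H x) ->
    (forall i j : 'I_n, (k <= i)%N -> H i j = 0) ->
  exists s : seq (R * 'rV[R]_n), (forall p, p \in s -> 0 <= p.1) /\
    forall i j, H i j = \sum_(p <- s) p.1 * p.2 0 i * p.2 0 j.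
  by apply: (Hk n) => // i j; rewrite leqNgt ltn_ord.
elim: k => [_|k IH kn] {symH psdH}H symH psdH H0.
  by exists [::]; split => // i j; rewrite big_nil H0.
pose k' := Ordinal kn.
have [Hkk0|Hkk0] := eqVneq (H k' k') 0.
  apply: (IH (ltnW kn)) => // i j; rewrite leq_eqVlt => /predU1P[ki|]; last exact: H0.
  have {i ki}-> : i = k' by apply/val_inj.
  apply/eqP; apply: contraT => Hkj.
  have := psdH (delta_mx 0 j + (- ((H j j + 1) / (H k' j *+ 2))) *: delta_mx 0 k').
  rewrite qformD_delta// Hkk0 mulr0 addr0 qform_delta.
  rewrite (eq_bigr (fun i => H k' i * (i == j)%:R)); last first.
    by move=> i _; rewrite mxE eqxx.
  rewrite sum_pick -mulrnAr mulNr divfK ?mulrn_eq0//.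
  by rewrite opprD addNKr oppr_ge0 ler10.
have Hkk : 0 < H k' k'.
  by rewrite lt_neqAle eq_sym Hkk0 -qform_delta psdH.
pose H' := \matrix_(i, j) (H i j - (H k' k')^-1 * H k' i * H k' j).
have symH' : H'^T = H'.
  by apply/matrixP => i j; rewrite !mxE -{1}symH mxE mulrAC.
have psdH' x : 0 <= qform H' x.
  pose c := \sum_j H k' j * x 0 j.
  have -> : qform H' x = qform H (x + (- (c / H k' k')) *: delta_mx 0 k').
    rewrite qformD_delta//.
    transitivity (qform H x - (H k' k')^-1 * c ^+ 2); last first.
      by rewrite -/c; field.
    rewrite /qform expr2 /c big_distrlr/= mulr_sumr -sumrB.
    apply: eq_bigr => i _; rewrite mulr_sumr -sumrB; apply: eq_bigr => j _.
    by rewrite mxE; ring.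
  exact: psdH.
have [i j|s [s0 sE]] := IH (ltnW kn) _ symH' psdH' _.
  rewrite leq_eqVlt => /predU1P[ki|ki]; rewrite mxE.
    have -> : i = k' by apply/val_inj.
    by rewrite mulVf// mul1r subrr.
  have -> : H k' i = H i k' by rewrite -{1}symH mxE.
  by rewrite (H0 i j)// (H0 i k')// mulr0 mul0r subrr.
exists (((H k' k')^-1, \row_i H k' i) :: s); split.
  move=> p; rewrite inE => /predU1P[->|/s0//].
  by rewrite /= invr_ge0 ltW.
by move=> i j; rewrite big_cons -sE !mxE/= addrC subrK.
Qed.

Lemma psd_pairing_ge0 A H : (forall x, 0 <= qform A x) ->
  H^T = H -> (forall x, 0 <= qform H x) -> 0 <= \sum_i \sum_j A i j * H i j.
Proof.
move=> psdA symH /(psd_sum_squares symH)[s [s0 sE]].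
have -> : \sum_i \sum_j A i j * H i j = \sum_(p <- s) p.1 * qform A p.2.
  under [RHS]eq_bigr do rewrite /qform mulr_sumr.
  rewrite [RHS]exchange_big; apply: eq_bigr => i _ /=.
  under [RHS]eq_bigr do rewrite mulr_sumr.
  rewrite [RHS]exchange_big; apply: eq_bigr => j _ /=.
  by rewrite sE mulr_sumr; apply: eq_bigr => p _; ring.
by rewrite big_seq; apply: sumr_ge0 => p /s0 p0; rewrite mulr_ge0.
Qed.

End psd_pairing.

Section maximum_principle.
Context {R : realType} {d : nat}.
Local Notation V := 'rV[R]_d.
Local Notation e_ i := (basis_vector i : V).
Implicit Types (U : set V) (f : V -> R) (x xi : V).

Lemma is_derive_row f (G : 'I_d -> V -> R) x xi :
  (forall i, \near x, is_derive x (e_ i) f (G i x)) ->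
  (forall i, {for x, continuous (G i)}) ->
  is_derive x xi f (\sum_i xi 0 i * G i x).
Proof.
move=> fG cG; rewrite {1}[xi]row_sum_delta.
elim: (index_enum _) => [|i s IH]; first by rewrite !big_nil; exact: is_derive0.
rewrite !big_cons.
apply: (@is_derive_add_dir R V f (fun y => xi 0 i * G i y)) => //.
  by apply: filterS (fG i) => y fy; exact: is_deriveZdir.
exact: (cvgMl_tmp (cG i)).
Qed.

(* [G i] is the i-th partial derivative of [f] and [H i j] the j-th partial
   derivative of [G i]. *)
Record C2_on U f (G : 'I_d -> V -> R) (H : 'I_d -> 'I_d -> V -> R) : Prop := {
  C2_grad : forall i x, U x -> is_derive x (e_ i) f (G i x);
  C2_grad_cont : forall i x, U x -> {for x, continuous (G i)};
  C2_hess : forall i j x, U x -> is_derive x (e_ j) (G i) (H i j x);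
  C2_hess_cont : forall i j x, U x -> {for x, continuous (H i j)} }.

Arguments C2_grad {U f G H} _ i x _.
Arguments C2_grad_cont {U f G H} _ i x _.
Arguments C2_hess {U f G H} _ i j x _.
Arguments C2_hess_cont {U f G H} _ i j x _.

Lemma C2_on_subset U U' f G H : U' `<=` U -> C2_on U f G H -> C2_on U' f G H.
Proof.
move=> UU' [h1 h2 h3 h4].
by split=> *; [apply: h1|apply: h2|apply: h3|apply: h4]; exact: UU'.
Qed.

Lemma C2_on_lin U (c1 c2 : R) f1 G1 H1 f2 G2 H2 :
  C2_on U f1 G1 H1 -> C2_on U f2 G2 H2 ->
  C2_on U (fun x => c1 * f1 x + c2 * f2 x) (fun i x => c1 * G1 i x + c2 * G2 i x)
    (fun i j x => c1 * H1 i j x + c2 * H2 i j x).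
Proof.
move=> [a1 b1 p1 q1] [a2 b2 p2 q2]; split.
- move=> i x Ux; have := a1 i x Ux; have := a2 i x Ux => *.
  exact: (is_deriveD (is_deriveZ _ _) (is_deriveZ _ _)).
- by move=> i x Ux; apply: (cvgD (cvgMl_tmp (b1 i x Ux)) (cvgMl_tmp (b2 i x Ux))).
- move=> i j x Ux; have := p1 i j x Ux; have := p2 i j x Ux => *.
  exact: (is_deriveD (is_deriveZ _ _) (is_deriveZ _ _)).
- by move=> i j x Ux; apply: (cvgD (cvgMl_tmp (q1 i j x Ux)) (cvgMl_tmp (q2 i j x Ux))).
Qed.

Lemma C2_on_cst U (c : R) : C2_on U (cst c) (fun=> cst 0) (fun _ _ => cst 0).
Proof.
split=> [i x Ux|i x Ux|i j x Ux|i j x Ux].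
- exact: (is_derive_cst c x (e_ i)).
- exact: cst_continuous.
- exact: (is_derive_cst (0 : R) x (e_ j)).
- exact: cst_continuous.
Qed.

Lemma Ck2_C2_on U f : Ck 2 U f ->
  C2_on U f (fun i => 'D_(e_ i) f) (fun i j => 'D_(e_ j) ('D_(e_ i) f)).
Proof.
case=> _ f2; split.
- by move=> i x /(proj1 (f2 i)) /derivableP.
- by move=> i x Ux; have [_ [+ _]] := f2 i; exact.
- by move=> i j x Ux; have [_ [_ /(_ j)[+ _]]] := f2 i; move=> /(_ _ Ux)/derivableP.
- by move=> i j x Ux; have [_ [_ /(_ j)[_ [+ _]]]] := f2 i; exact.
Qed.

Lemma hessian_sym U f G H x i j : open U -> C2_on U f G H -> U x ->
  H i j x = H j i x.
Proof.
move=> oU fC2 Ux; apply/eqP; rewrite -subr_eq0 -normr_eq0 eq_le normr_ge0 andbT.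
apply/ler_addgt0Pr => e e0; rewrite add0r.
have e20 : 0 < e / 2 by rewrite divr_gt0.
have nH k l : \forall y \near x, `|H k l x - H k l y| < e / 2.
  by have := C2_hess_cont fC2 k l x Ux => /cvgrPdist_lt /(_ _ e20).
have nU : \near x, U x by exact: open_nbhs_nbhs.
have /nbhs_ballP[r /= r0 xr] : \forall y \near x, U y /\
    `|H i j x - H i j y| < e / 2 /\ `|H j i x - H j i y| < e / 2.
  exact: filterI nU (filterI (nH i j) (nH j i)).
pose k : R := `|e_ i| + `|e_ j| + 1.
have k0 : 0 < k by rewrite ltr_pwDr// addr_ge0.
pose s := r / k / 2.
have s0 : 0 < s by rewrite !divr_gt0.
have sk : s * k < r.
  by rewrite -ltr_pdivlMr// ltr_pdivrMr// ltr_pMr ?divr_gt0// ltr1n.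
have xab u v a b : `|u| + `|v| <= k -> 0 <= a <= s -> 0 <= b <= s ->
    ball x r (x + a *: u + b *: v).
  move=> uvk /andP[a0 a1] /andP[b0 b1]; rewrite -ball_normE/= -addrA opprD addNKr normrN.
  rewrite (le_lt_trans (ler_normD _ _))// !normrZ !ger0_norm// (le_lt_trans _ sk)//.
  rewrite (@le_trans _ _ (s * (`|u| + `|v|)))//.
    by rewrite mulrDr lerD// ler_wpM2r.
  by rewrite ler_wpM2l// ltW.
have ijk : `|e_ i| + `|e_ j| <= k by rewrite lerDl.
have jik : `|e_ j| + `|e_ i| <= k by rewrite addrC.
have [|a [b [/andP[a0 a1] /andP[b0 b1] E]]] :=
    @mixed_MVT R V f (G i) (H i j) x (e_ i) (e_ j) s s0.
  move=> a b a0s b0s; have [Uab _] := xr _ (xab _ _ _ _ ijk a0s b0s).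
  by split; [exact: (C2_grad fC2)|exact: (C2_hess fC2)].
have [|a' [b' [/andP[a'0 a'1] /andP[b'0 b'1] E']]] :=
    @mixed_MVT R V f (G j) (H j i) x (e_ j) (e_ i) s s0.
  move=> a' b' a0s b0s; have [Uab _] := xr _ (xab _ _ _ _ jik a0s b0s).
  by split; [exact: (C2_grad fC2)|exact: (C2_hess fC2)].
have : s * (s * H i j (x + a *: e_ i + b *: e_ j)) =
       s * (s * H j i (x + a' *: e_ j + b' *: e_ i)).
  by rewrite -E -E' [x + _ + s *: e_ i]addrAC; ring.
move/(mulfI (lt0r_neq0 s0))/(mulfI (lt0r_neq0 s0)) => HH.
have a0s : 0 <= a <= s by rewrite !ltW.
have b0s : 0 <= b <= s by rewrite !ltW.
have a'0s : 0 <= a' <= s by rewrite !ltW.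
have b'0s : 0 <= b' <= s by rewrite !ltW.
have [_ [h1 _]] := xr _ (xab _ _ _ _ ijk a0s b0s).
have [_ [_ h2]] := xr _ (xab _ _ _ _ jik a'0s b'0s).
rewrite -HH in h2.
rewrite -(subrK (H i j (x + a *: e_ i + b *: e_ j)) (H i j x)) -addrA.
rewrite (le_trans (ler_normD _ _))// [e]splitr lerD// ltW//.
by rewrite distrC.
Qed.

Lemma local_max_hessian U f G H x : open U -> C2_on U f G H -> U x ->
  (forall y, U y -> f y <= f x) ->
  (forall i, G i x = 0) /\ forall xi, qform (\matrix_(i, j) H i j x) xi <= 0.
Proof.
move=> oU fC2 Ux fmax.
have nU y : U y -> \near y, U y by move=> Uy; exact: open_nbhs_nbhs.
split=> [i|xi].
  exact: (local_max_derive_eq0 oU Ux (fun y Uy => C2_grad fC2 i y Uy)).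
apply: (@local_max_derive2_le0 R V U f (fun y => \sum_i xi 0 i * G i y) x xi) => //.
  move=> y Uy; apply: is_derive_row => i; last exact: (C2_grad_cont fC2).
  by apply: filterS (nU _ Uy) => z; exact: (C2_grad fC2).
rewrite (_ : qform _ _ = \sum_i xi 0 i * \sum_j xi 0 j * H i j x); last first.
  apply: eq_bigr => i _; rewrite mulr_sumr; apply: eq_bigr => j _.
  by rewrite mxE; ring.
rewrite (_ : (fun y => _) = \sum_i (fun y => xi 0 i * G i y)); last first.
  by apply/funext => y; rewrite fct_sumE.
apply: is_derive_sum => i; apply: is_deriveZ; apply: is_derive_row => j.
  by apply: filterS (nU _ Ux) => z; exact: (C2_hess fC2).
exact: (C2_hess_cont fC2).
Qed.

Lemma bounded_closure U : bounded_set U -> bounded_set (closure U).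
Proof.
move=> [M [Mr bM]]; exists (M + 2); split; first by rewrite num_real.
move=> r Mr2 x clx; have [y [Uy]] := clx _ (nbhsx_ballx x 1 ltr01).
rewrite -ball_normE/= => xy; rewrite -(subrK y x) (le_trans (ler_normD _ _))//.
have yM : `|y| <= M + 1 by apply: bM => //; rewrite ltrDl.
by rewrite (le_trans (lerD (ltW xy) yM))//; lra.
Qed.

Definition nondiv (A : V -> 'M[R]_d) (b : V -> 'I_d -> R)
    (G : 'I_d -> V -> R) (H : 'I_d -> 'I_d -> V -> R) x : R :=
  \sum_i \sum_j A x i j * H i j x + \sum_j b x j * G j x.

Lemma nondiv_lin A b (c1 c2 : R) G1 H1 G2 H2 x :
  nondiv A b (fun i y => c1 * G1 i y + c2 * G2 i y)
    (fun i j y => c1 * H1 i j y + c2 * H2 i j y) x =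
  c1 * nondiv A b G1 H1 x + c2 * nondiv A b G2 H2 x.
Proof.
rewrite /nondiv !mulrDr addrACA; congr (_ + _); rewrite !mulr_sumr -big_split.
  apply: eq_bigr => i _; rewrite !mulr_sumr -big_split; apply: eq_bigr => j _.
  by rewrite /=; ring.
by apply: eq_bigr => i _ /=; ring.
Qed.

Lemma maximum_principle A b U f G H : open U -> bounded_set U ->
  (forall x xi, U x -> 0 <= qform (A x) xi) ->
  C2_on U f G H -> {within closure U, continuous f} ->
  (forall x, U x -> 0 < nondiv A b G H x) ->
  (forall x, closure U x -> ~ U x -> f x <= 0) ->
  forall x, U x -> f x <= 0.
Proof.
move=> oU bU psdA fC2 cf Lf fb x Ux; rewrite leNgt; apply/negP => fx0.
have clU : compact (closure U).
  by apply: bounded_closed_compact; [exact: bounded_closure|exact: closed_closure].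
have [c] := compact_EVT_max (ex_intro _ x (subset_closure Ux)) clU cf.
rewrite inE => clc cmax.
have fc0 : 0 < f c by rewrite (lt_le_trans fx0)// cmax// inE; exact: subset_closure.
have Uc : U c.
  by apply: contrapT => nUc; have := fb c clc nUc; rewrite leNgt fc0.
have [|Gc Hc] := local_max_hessian oU fC2 Uc.
  by move=> y Uy; apply: cmax; rewrite inE; exact: subset_closure.
have := Lf _ Uc; rewrite /nondiv [X in _ + X]big1 ?addr0; last first.
  by move=> j _; rewrite Gc mulr0.
rewrite ltNge => /negP; apply.
have := @psd_pairing_ge0 R d (A c) (- \matrix_(i, j) H i j c).
rewrite -oppr_ge0 -sumrN => /(_ (fun xi => psdA c xi Uc)).
have -> : \sum_i \sum_j A c i j * (- \matrix_(i, j) H i j c) i j =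
          \sum_i - \sum_j A c i j * H i j c.
  apply: eq_bigr => i _; rewrite -sumrN; apply: eq_bigr => j _.
  by rewrite !mxE mulrN.
apply; first by apply/matrixP => i j; rewrite !mxE (hessian_sym i j oU fC2 Uc).
move=> xi; have := Hc xi; rewrite -oppr_ge0 /qform -sumrN.
rewrite (eq_bigr (fun i => \sum_j (- \matrix_(i, j) H i j c) i j * xi 0 i * xi 0 j))//.
by move=> i _; rewrite -sumrN; apply: eq_bigr => j _; rewrite !mxE !mulNr.
Qed.
End maximum_principle.
Arguments C2_grad {R d U f G H} _ i x _.
Arguments C2_grad_cont {R d U f G H} _ i x _.
Arguments C2_hess {R d U f G H} _ i j x _.
Arguments C2_hess_cont {R d U f G H} _ i j x _.

Section barrier_functions.
Context {R : realType} {d : nat}.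
Local Notation V := 'rV[R]_d.
Local Notation e_ i := (basis_vector i : V).
Implicit Types (U D : set V) (f : V -> R) (x y z nu p : V).

Lemma dotmulC x y : dotmul x y = dotmul y x.
Proof. by apply: eq_bigr => i _; rewrite mulrC. Qed.

Lemma dotmulDr x y z : dotmul x (y + z) = dotmul x y + dotmul x z.
Proof. by rewrite -big_split; apply: eq_bigr => i _; rewrite mxE mulrDr. Qed.

Lemma dotmulZr x (a : R) y : dotmul x (a *: y) = a * dotmul x y.
Proof. by rewrite mulr_sumr; apply: eq_bigr => i _; rewrite mxE mulrCA. Qed.

Lemma dotmulBr x y z : dotmul x (y - z) = dotmul x y - dotmul x z.
Proof. by rewrite dotmulDr -scaleN1r dotmulZr mulN1r. Qed.

Lemma dotmul_sqrD x y :
  dotmul (x + y) (x + y) = dotmul x x + 2 * dotmul x y + dotmul y y.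
Proof.
rewrite dotmulDr ![dotmul (x + y) _]dotmulC !dotmulDr [dotmul y x]dotmulC.
by rewrite mulr_natl mulr2n !addrA.
Qed.

Lemma dotmul_basis x i : dotmul x (e_ i) = x 0 i.
Proof.
rewrite -[RHS](sum_pick (fun j => x 0 j)); apply: eq_bigr => j _.
by rewrite mxE eqxx.
Qed.

Lemma coord_le_norm x i : `|x 0 i| <= `|x|.
Proof.
by rewrite [leRHS]/Num.norm/= mx_normrE; apply/bigmax_geP; right; exists (0, i).
Qed.

Lemma rV_norm_le x (r : R) : 0 <= r -> (forall i, `|x 0 i| <= r) -> `|x| <= r.
Proof.
move=> r0 xr; rewrite /Num.norm/= mx_normrE; apply/bigmax_leP.
by split => // -[i j] _ /=; rewrite ord1.
Qed.

Lemma dotmul_le (b y : 'I_d -> R) (B Y : R) :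
  (forall i, `|b i| <= B) -> (forall i, `|y i| <= Y) ->
  `|\sum_i b i * y i| <= d%:R * (B * Y).
Proof.
move=> bB yY; rewrite (le_trans (ler_norm_sum _ _ _))//.
rewrite -[in leRHS](card_ord d) -sumr_const mulr_suml ler_sum// => i _.
by rewrite mul1r normrM ler_pM.
Qed.

Lemma sqr_norm_le_dotmul x : `|x| ^+ 2 <= dotmul x x.
Proof.
have xx0 : 0 <= dotmul x x by apply: sumr_ge0 => i _; rewrite -expr2 sqr_ge0.
rewrite -[leRHS]sqr_sqrtr// ler_sqr ?nnegrE ?sqrtr_ge0//.
apply: rV_norm_le => [|i]; first exact: sqrtr_ge0.
rewrite -sqrtr_sqr ler_sqrt// /dotmul (bigD1 i)//= -expr2 lerDl.
by apply: sumr_ge0 => j _; rewrite -expr2 sqr_ge0.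
Qed.

Lemma unit_vector_coord nu i : unit_vector nu -> `|nu 0 i| <= 1.
Proof.
move=> nu1; rewrite (le_trans (coord_le_norm _ _))//.
by rewrite -(@expr_le1 _ 2)// (le_trans (sqr_norm_le_dotmul _))// nu1.
Qed.

Lemma coord_cont i : continuous (fun x : V => x 0 i).
Proof. by move=> x; exact: coord_continuous. Qed.

Lemma dotmul_cont y : continuous (dotmul y).
Proof.
apply: continuous_big => [|i _ x]; first exact: add_continuous.
exact: (cvgMl_tmp (@coord_cont i x)).
Qed.

Lemma is_derive_coord x z i : is_derive x z (fun y : V => y 0 i) (z 0 i).
Proof.
apply: is_derive_line0.
rewrite (_ : (fun _ => _) = fun s : R => x 0 i + s * z 0 i); last first.
  by apply/funext => s; rewrite !mxE.
by apply: is_derive_eq; rewrite /GRing.scale/=; ring.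
Qed.

Definition wave nu (c l : R) x : R := expR (l * (dotmul nu x - c)).

Lemma wave_cont nu c l : continuous (wave nu c l).
Proof.
move=> x; apply: continuous_comp; last exact: continuous_expR.
exact: (cvgMl_tmp (cvgB (@dotmul_cont nu x) (cvg_cst c))).
Qed.

Lemma is_derive_wave nu c l x z :
  is_derive x z (wave nu c l) (l * dotmul nu z * wave nu c l x).
Proof.
apply: is_derive_line0.
rewrite (_ : (fun _ => _) = expR \o
   (fun s : R => l * (dotmul nu x - c) + s * (l * dotmul nu z))); last first.
  by apply/funext => s /=; rewrite /wave dotmulDr dotmulZr; congr expR; ring.
rewrite [X in is_derive _ _ _ X]mulrC; apply: is_derive1_comp.
  by apply: is_derive_eq; rewrite mul0r addr0.
by apply: is_derive_eq; rewrite /GRing.scale/=; ring.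
Qed.

Lemma C2_on_wave U nu c l : C2_on U (wave nu c l)
  (fun i x => l * nu 0 i * wave nu c l x)
  (fun i j x => l * nu 0 i * (l * nu 0 j * wave nu c l x)).
Proof.
split=> [i x _|i x _|i j x _|i j x _].
- by rewrite -dotmul_basis; exact: is_derive_wave.
- exact: (cvgMl_tmp (@wave_cont nu c l x)).
- by rewrite -(dotmul_basis nu j); apply: is_deriveZ; exact: is_derive_wave.
- exact: (cvgMl_tmp (cvgMl_tmp (@wave_cont nu c l x))).
Qed.

Definition sqdist p x : R := dotmul (x - p) (x - p).

Lemma sqdist_cont p : continuous (sqdist p).
Proof.
apply: continuous_big => [|i _ x]; first exact: add_continuous.
have h : (y - p) 0 i @[y --> x] --> (x - p) 0 i.
  under eq_cvg do rewrite 2!mxE.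
  by rewrite 2!mxE; exact: (cvgB (@coord_cont i x) (cvg_cst (p 0 i))).
exact: (cvgM h h).
Qed.

Lemma C2_on_sqdist U p : C2_on U (sqdist p)
  (fun i x => 2 * (x 0 i - p 0 i)) (fun i j x => 2 * (i == j)%:R).
Proof.
split=> [i x _|i x _|i j x _|i j x _].
- apply: is_derive_line0.
  rewrite (_ : (fun _ => _) = fun s : R => sqdist p x +
      s * (2 * (x 0 i - p 0 i)) + s * s); last first.
    apply/funext => s; rewrite /sqdist [x + _ - p]addrAC (dotmul_sqrD (x - p)) !dotmulZr.
    rewrite [dotmul (_ *: _) _]dotmulC dotmulZr !dotmul_basis !mxE !eqxx/=.
    by ring.
  by apply: is_derive_eq; rewrite /GRing.scale/=; ring.
- exact: (cvgMl_tmp (cvgB (@coord_cont i x) (cvg_cst (p 0 i)))).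
- apply: is_deriveZ; rewrite (_ : (i == j)%:R = (e_ j : V) 0 i - 0); last first.
    by rewrite subr0 mxE eqxx.
  exact: (is_deriveB (is_derive_coord _ _ _) (is_derive_cst (p 0 i) _ _)).
- exact: cst_continuous.
Qed.

Lemma nondiv_cst A b x : @nondiv R d A b (fun=> cst 0) (fun _ _ => cst 0) x = 0.
Proof.
by rewrite /nondiv !big1 ?addr0// => i _; rewrite ?mulr0// big1// => j _; rewrite mulr0.
Qed.

Lemma nondiv_wave A b nu c l x :
  nondiv A b (fun i x => l * nu 0 i * wave nu c l x)
    (fun i j x => l * nu 0 i * (l * nu 0 j * wave nu c l x)) x =
  wave nu c l x * (l ^+ 2 * qform (A x) nu + l * \sum_j b x j * nu 0 j).
Proof.
rewrite /nondiv mulrDr /qform !mulr_sumr; congr (_ + _); last first.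
  by apply: eq_bigr => i _; ring.
by apply: eq_bigr => i _; rewrite !mulr_sumr; apply: eq_bigr => j _; ring.
Qed.

Lemma nondiv_sqdist A b p x :
  nondiv A b (fun i x => 2 * (x 0 i - p 0 i)) (fun i j x => 2 * (i == j)%:R) x =
  2 * (\tr (A x) + \sum_j b x j * (x 0 j - p 0 j)).
Proof.
rewrite /nondiv mulrDr /mxtrace !mulr_sumr; congr (_ + _); last first.
  by apply: eq_bigr => i _; ring.
apply: eq_bigr => i _; rewrite -(sum_pick (fun j => A x i j)) mulr_sumr.
by apply: eq_bigr => j _; rewrite eq_sym; ring.
Qed.

End barrier_functions.

Section dirichlet_problem.
Context {R : realType} {d : nat}.
Local Notation V := 'rV[R]_d.
Local Notation e_ i := (basis_vector i : V).
Implicit Types (U D : set V) (A : V -> 'M[R]_d) (f v phi : V -> R).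
Implicit Types (x y z nu p : V).

Definition drift (A : V -> 'M[R]_d) x (j : 'I_d) : R :=
  \sum_i 'D_(e_ i) (fun y => A y i j) x.

Definition nondiv_solution A D phi v : Prop := exists G H,
  [/\ C2_on D v G H, {within closure D, continuous v},
      forall x, D x -> nondiv A (drift A) G H x = 0 &
      forall x, boundary D x -> v x = phi x].

Lemma nondiv_solution_lin A D (c1 c2 : R) phi1 phi2 v1 v2 :
  nondiv_solution A D phi1 v1 -> nondiv_solution A D phi2 v2 ->
  nondiv_solution A D (fun x => c1 * phi1 x + c2 * phi2 x)
    (fun x => c1 * v1 x + c2 * v2 x).
Proof.
move=> [G1 [H1 [C1 c1' L1 b1]]] [G2 [H2 [C2 c2' L2 b2]]].
exists (fun i x => c1 * G1 i x + c2 * G2 i x),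
  (fun i j x => c1 * H1 i j x + c2 * H2 i j x).
split.
- exact: C2_on_lin.
- by move=> x; exact: (cvgD (cvgMl_tmp (c1' x)) (cvgMl_tmp (c2' x))).
- by move=> x Dx; rewrite nondiv_lin L1// L2// !mulr0 addr0.
- by move=> x bx; rewrite b1// b2.
Qed.

Lemma divform_nondiv A D v x : open D -> D x -> Ck 2 D v ->
  (forall i j, Ck 1 setT (fun x => A x i j)) ->
  divform A v x = - nondiv A (drift A) (fun i => 'D_(e_ i) v)
    (fun i j => 'D_(e_ j) ('D_(e_ i) v)) x.
Proof.
move=> oD Dx /Ck2_C2_on vC2 A1; rewrite /divform; congr (- _).
rewrite /nondiv /drift; under [X in _ + X]eq_bigr do rewrite mulr_suml.
rewrite [X in _ + X]exchange_big -big_split/=; apply: eq_bigr => i _.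
rewrite -big_split/=.
rewrite (_ : (fun y => _) = \sum_j (fun y => A y i j * 'D_(e_ j) v y)); last first.
  by apply/funext => y; rewrite fct_sumE.
rewrite derive_sum; last first.
  move=> j; apply: derivableM; first by have [_ /(_ i)[+ _]] := A1 i j; exact.
  by have := C2_hess vC2 j i x Dx => -[].
apply: eq_bigr => j _; rewrite deriveM; last 2 first.
- by have [_ /(_ i)[+ _]] := A1 i j; exact.
- by have := C2_hess vC2 j i x Dx => -[].
rewrite -(hessian_sym j i oD vC2 Dx) /GRing.scale/=; congr (_ + _).
by rewrite mulrC.
Qed.

Lemma continuous_bounded D f : bounded_set D -> continuous f ->
  exists B : R, forall x, D x -> `|f x| <= B.
Proof.
move=> bD cf; have cD : compact (closure D).
  by apply: bounded_closed_compact; [exact: bounded_closure|exact: closed_closure].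
have /compact_bounded[B [_ fB]] : compact (f @` closure D).
  by apply: continuous_compact => //; exact: continuous_subspaceT.
exists (B + 1) => x Dx; apply: (fB (B + 1)); first by rewrite ltrDl.
by exists x => //; exact: subset_closure.
Qed.

Lemma drift_bounded A D : bounded_set D ->
  (forall i j, Ck 1 setT (fun x => A x i j)) ->
  exists B : R, forall x j, D x -> `|drift A x j| <= B.
Proof.
move=> bD A1.
have h i j : exists B : R, forall x, D x -> `|'D_(e_ i) (fun y => A y i j) x| <= B.
  apply: continuous_bounded => // x.
  by have [_ /(_ i)[_ [+ _]]] := A1 i j; exact.
pose B i j := projT1 (cid (h i j)).
have B0 i j x : D x -> `|'D_(e_ i) (fun y => A y i j) x| <= `|B i j|.
  by move=> Dx; rewrite (le_trans _ (ler_norm _))//; exact: (projT2 (cid (h i j))).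
exists (\sum_i \sum_j `|B i j|) => x j Dx.
rewrite (le_trans (ler_norm_sum _ _ _))// ler_sum// => i _.
rewrite (le_trans (B0 i j x Dx))// (bigD1 j)//= lerDl.
by apply: sumr_ge0.
Qed.

Section barrier.
Variables (D : set V) (A : V -> 'M[R]_d) (nu : V) (c cA B S : R).
Hypotheses (oD : open D) (bD : bounded_set D).
Hypotheses (nu1 : unit_vector nu) (Dnu : forall x, D x -> c < dotmul nu x).
Hypotheses (cA0 : 0 < cA) (ellA : forall x xi, cA^-1 * dotmul xi xi <= qform (A x) xi).
Hypothesis trA : forall x, \tr (A x) <= d%:R * cA.
Hypotheses (B0 : 0 <= B) (dB : forall x j, D x -> `|drift A x j| <= B).
Hypotheses (S0 : 0 <= S) (DS : forall x, closure D x -> `|x| <= S).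

Let dR : R := d%:R.
Let dR0 : 0 <= dR. Proof. exact: ler0n. Qed.

Let psdA x xi : 0 <= qform (A x) xi.
Proof.
apply: le_trans (ellA x xi); apply: mulr_ge0; first by rewrite invr_ge0 ltW.
by apply: sumr_ge0 => i _; rewrite -expr2 sqr_ge0.
Qed.

Let qA x : cA^-1 <= qform (A x) nu.
Proof. by have := ellA x nu; rewrite nu1 mulr1. Qed.

Let drift_nu x : D x -> `|\sum_j drift A x j * nu 0 j| <= dR * B.
Proof.
move=> Dx; rewrite -[B]mulr1; apply: dotmul_le => i; first exact: dB.
exact: unit_vector_coord.
Qed.

Let closure_ge x : closure D x -> c <= dotmul nu x.
Proof.
move=> clx; have cl : closed [set y | c <= dotmul nu y].
  apply: (@closed_comp _ _ (dotmul nu) [set r | c <= r]).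
    by move=> *; exact: dotmul_cont.
  exact: closed_ge.
suff : closure [set y | c <= dotmul nu y] x by rewrite -(closure_id _).1.
by apply: closure_subset clx => y /Dnu /ltW.
Qed.

Lemma solution_lower_bound M phi v : (forall x, boundary D x -> - M <= phi x) ->
  nondiv_solution A D phi v -> forall x, D x -> - M <= v x.
Proof.
move=> phiM [G [H [vC2 cv Lv bv]]] x Dx.
pose l := cA * (dR * B + 1).
have l0 : 0 < l by rewrite mulr_gt0// ltr_wpDl// mulr_ge0.
pose K := expR (l * (dR * S + `|c|)).
have waveK y : closure D y -> wave nu c l y <= K.
  move=> /DS yS; rewrite ler_expR; apply: ler_wpM2l; first exact: ltW.
  rewrite (le_trans (ler_norm _))//.
  rewrite (le_trans (ler_normB _ _))// lerD// -[S]mul1r; apply: dotmul_le => i.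
    exact: unit_vector_coord.
  exact: le_trans (coord_le_norm _ _) yS.
have K0 : 0 < K by exact: expR_gt0.
apply/ler_addgt0Pr => e e0.
pose eta := e / K.
have eta0 : 0 < eta by exact: divr_gt0.
have fC2 := C2_on_lin (-1) 1 vC2
  (C2_on_lin eta (- (M + e)) (C2_on_wave D nu c l) (C2_on_cst D 1)).
have := @maximum_principle R d A (drift A) D _ _ _ oD bD (fun x xi _ => psdA x xi) fC2.
have clb y : closure D y -> ~ D y -> boundary D y.
  by move=> cly nDy; split => // /interior_subset.
move=> /(_ _ _ _ x Dx) H'.
have : -1 * v x + 1 * (eta * wave nu c l x + - (M + e) * cst 1 x) <= 0.
  apply: H'.
  - have cw : {within closure D, continuous (fun y =>
        eta * wave nu c l y + - (M + e) * cst 1 y)}.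
      apply: continuous_subspaceT => y.
      exact: (cvgD (cvgMl_tmp (@wave_cont R d nu c l y)) (cvg_cst _)).
    by move=> y; exact: (cvgD (cvgMl_tmp (cv y)) (cvgMl_tmp (cw y))).
  - move=> y Dy; rewrite !nondiv_lin Lv// nondiv_wave nondiv_cst.
    rewrite !mulr0 addr0 add0r mul1r; apply: mulr_gt0 => //.
    apply: mulr_gt0; first exact: expR_gt0.
    rewrite expr2 -mulrA -mulrDr mulr_gt0//.
    have : l * cA^-1 <= l * qform (A y) nu by rewrite ler_wpM2l// ltW.
    rewrite /l mulrAC mulfV ?gt_eqF// mul1r -/l.
    have := drift_nu Dy; rewrite ler_norml => /andP[+ _]; lra.
  - move=> y cly nDy; rewrite bv; last exact: clb.
    have := phiM y (clb y cly nDy).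
    have : eta * wave nu c l y <= e.
      by rewrite /eta mulrAC ler_pdivrMr// ler_wpM2l ?waveK// ltW.
    rewrite /cst; lra.
have : 0 <= eta * wave nu c l x by rewrite mulr_ge0 ?expR_ge0// ltW.
rewrite /cst; lra.
Qed.

Lemma boundary_lower_bound M delta rho : 0 <= M -> 0 < delta -> 0 < rho ->
  exists2 r0 : R, 0 < r0 & forall eps phi v p,
    0 < eps <= 1 -> dotmul nu p = c -> `|p| <= S ->
    (forall x, boundary D x -> - M <= phi x) ->
    (forall x, boundary D x -> `|x - p| < rho * eps -> 2 * delta <= phi x) ->
    nondiv_solution A D phi v ->
    forall x, D x -> `|x - p| <= r0 * eps -> delta <= v x.
Proof.
move=> M0 delta0 rho0.
pose T := 2 * (dR * cA + dR * (B * (S + S))).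
pose K := (M + 2 * delta) / rho ^+ 2.
pose l := cA * (dR * B + 1).
have l0 : 0 < l by rewrite mulr_gt0// ltr_wpDl// mulr_ge0.
have El1 : 0 < 1 - expR (- l) by rewrite subr_gt0 expR_lt1 oppr_lt0.
have M2 : 0 < M + 2 * delta by rewrite ltr_wpDl// mulr_gt0.
have K0 : 0 < K by rewrite divr_gt0// exprn_gt0.
have T0 : 0 <= T.
  apply: mulr_ge0 => //; apply: addr_ge0; first by rewrite mulr_ge0// ltW.
  by rewrite !mulr_ge0// addr_ge0.
pose M' := (K * T + 1) * (expR l / l) + (M + 2 * delta) / (1 - expR (- l)).
have KT0 : 0 < K * T + 1 by rewrite ltr_wpDl// mulr_ge0// ltW.
have M'a : (K * T + 1) * (expR l / l) <= M' by rewrite lerDl ltW// divr_gt0.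
have M'b : (M + 2 * delta) / (1 - expR (- l)) <= M'.
  by rewrite lerDr ltW// mulr_gt0// divr_gt0// expR_gt0.
have M'0 : 0 < M' by rewrite (lt_le_trans _ M'b)// divr_gt0.
have M'1 : K * T + 1 <= M' * (expR (- l) * l).
  have e1 : expR l / l * (expR (- l) * l) = 1.
    by rewrite expRN; field; rewrite !gt_eqF// expR_gt0.
  have el0 : 0 <= expR (- l) * l by rewrite mulr_ge0 ?expR_ge0// ltW.
  by have := ler_wpM2r el0 M'a; rewrite -mulrA e1 mulr1.
have M'2 : M + 2 * delta <= M' * (1 - expR (- l)) by rewrite -ler_pdivrMr.
pose den := delta * (dR + 1) + (K + M' * l) * dR.
have KM0 : 0 < K + M' * l by rewrite addr_gt0// mulr_gt0.
have den0 : 0 < den.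
  rewrite ltr_wpDr//; first by rewrite mulr_ge0// ltW.
  by rewrite mulr_gt0// ltr_wpDl.
have r00 : 0 < delta / den by rewrite divr_gt0.
have r0d : delta / den * (dR + 1) <= 1.
  by rewrite mulrAC ler_pdivrMr// mul1r lerDl mulr_ge0// ltW.
have r0K : delta / den * ((K + M' * l) * dR) <= delta.
  rewrite mulrAC ler_pdivrMr// (ler_wpM2l (ltW delta0))// lerDr.
  by rewrite mulr_ge0 ?addr_ge0// ltW.
exists (delta / den) => // eps phi v p /andP[eps0 eps1] nup pS phiM phip vsol x Dx xp.
move: (delta / den) r00 r0d r0K xp => r0 r00 r0d r0K xp.
have vM := solution_lower_bound phiM vsol.
have [G [H [vC2 cv Lv bv]]] := vsol.
pose i := eps^-1.
have i0 : 0 < i by rewrite invr_gt0.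
have ei : eps * i = 1 by rewrite mulfV// gt_eqF.
pose E := wave nu c (- (l * i)).
pose f y := -1 * v y + 1 * (- (K * i ^+ 2) * sqdist p y +
    1 * (M' * E y + (2 * delta - M') * cst 1 y)).
pose U := D `&` [set y | dotmul nu y < c + eps].
have UD : U `<=` D by move=> y [].
have fC2 : C2_on U f _ _ := C2_on_lin (-1) 1 (C2_on_subset UD vC2)
  (C2_on_lin (- (K * i ^+ 2)) 1 (C2_on_sqdist U p)
     (C2_on_lin M' (2 * delta - M') (C2_on_wave U nu c (- (l * i))) (C2_on_cst U 1))).
have oU : open U.
  apply: openI => //; apply: (@open_comp _ _ (dotmul nu) [set r | r < c + eps]).
    by move=> *; exact: dotmul_cont.
  exact: open_lt.
have bU : bounded_set U.
  by case: bD => N [Nr DN]; exists N; split => // r rN y /UD; exact: DN.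
have clUD : closure U `<=` closure D by exact: closure_subset.
have clb y : closure D y -> ~ D y -> boundary D y.
  by move=> cly nDy; split => // /interior_subset.
have E1 y : closure D y -> E y <= 1.
  move=> cly; rewrite /E /wave -expR0 ler_expR mulNr oppr_le0 mulr_ge0//.
    by rewrite mulr_ge0// ltW.
  by rewrite subr_ge0 closure_ge.
have fU : forall y, U y -> f y <= 0.
  apply: (@maximum_principle R d A (drift A) U f _ _ oU bU (fun y xi _ => psdA y xi) fC2).
  - have cw : {within closure U, continuous (fun y =>
        - (K * i ^+ 2) * sqdist p y + 1 * (M' * E y + (2 * delta - M') * cst 1 y))}.
      apply: continuous_subspaceT => y.
      apply: (cvgD (cvgMl_tmp (@sqdist_cont R d p y)) (cvgMl_tmp _)).
      exact: (cvgD (cvgMl_tmp (@wave_cont R d nu c _ y)) (cvg_cst _)).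
    have cvU : {within closure U, continuous v} by exact: continuous_subspaceW cv.
    by move=> y; exact: (cvgD (cvgMl_tmp (cvU y)) (cvgMl_tmp (cw y))).
  - move=> y [Dy yc]; rewrite !nondiv_lin Lv// nondiv_wave nondiv_cst nondiv_sqdist.
    rewrite !mulr0 addr0 add0r !mul1r.
    have nup' : \sum_j drift A y j * (y 0 j - p 0 j) <= dR * (B * (S + S)).
      rewrite (le_trans (ler_norm _))//; apply: dotmul_le => j; first exact: dB.
      rewrite (le_trans (ler_normB _ _))// lerD// (le_trans (coord_le_norm _ _))//.
      by apply: DS; exact: subset_closure.
    have trT : 2 * (\tr (A y) + \sum_j drift A y j * (y 0 j - p 0 j)) <= T.
      by rewrite ler_wpM2l// lerD.
    have El : expR (- l) <= E y.
      rewrite /E /wave ler_expR mulNr lerN2.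
      rewrite -[leRHS]mulr1 -[l * i * _]mulrA (ler_wpM2l (ltW l0))//.
      by rewrite mulrC ler_pdivrMr// mul1r lerBlDl ltW.
    set q := qform (A y) nu; set bn := \sum_j drift A y j * nu 0 j.
    have Pl : l * i ^+ 2 <= (- (l * i)) ^+ 2 * q + - (l * i) * bn.
      have -> : (- (l * i)) ^+ 2 * q + - (l * i) * bn =
          (l * i ^+ 2) * (l * q - eps * bn).
        rewrite -[X in _ + X](mulr1 (- (l * i) * bn)) -ei; ring.
      rewrite -[leLHS]mulr1 ler_wpM2l//; first by rewrite ltW// mulr_gt0// exprn_gt0.
      have : l * cA^-1 <= l * q by apply: ler_wpM2l; [exact: ltW|exact: qA].
      rewrite {1}/l mulrAC mulfV ?gt_eqF// mul1r.
      have bnB : `|bn| <= dR * B by exact: drift_nu.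
      have : eps * bn <= dR * B.
        rewrite (le_trans (ler_norm _))// normrM gtr0_norm//.
        by rewrite (le_trans _ bnB)// ler_piMl.
      lra.
    have i20 : 0 < i ^+ 2 by exact: exprn_gt0.
    apply: (@lt_le_trans _ _ (- (K * i ^+ 2) * T + M' * (expR (- l) * (l * i ^+ 2)))).
      have -> : - (K * i ^+ 2) * T + M' * (expR (- l) * (l * i ^+ 2)) =
        i ^+ 2 * (M' * (expR (- l) * l) - K * T) by ring.
      rewrite mulr_gt0//; lra.
    apply: lerD; first by rewrite ler_wnM2l// oppr_le0 mulr_ge0// ltW.
    apply: ler_wpM2l; first exact: ltW.
    by apply: ler_pM => //; rewrite mulr_ge0// ltW.
  - move=> y cly nUy; have clDy := clUD _ cly; rewrite /f /cst.
    have [Dy|nDy] := pselect (D y).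
      have ys : c + eps <= dotmul nu y.
        by rewrite leNgt; apply/negP => ys; apply: nUy.
      have Ee : E y <= expR (- l).
        rewrite /E /wave ler_expR mulNr lerN2.
        rewrite -[leLHS]mulr1 -[l * i * _]mulrA (ler_wpM2l (ltW l0))//.
        by rewrite mulrC ler_pdivlMr// mul1r lerBrDl.
      have : 0 <= K * i ^+ 2 * sqdist p y.
        rewrite mulr_ge0//; last by apply: le_trans (sqr_norm_le_dotmul _); exact: sqr_ge0.
        by rewrite mulr_ge0 ?sqr_ge0// ltW.
      have : M' * E y <= M' * expR (- l) by rewrite ler_wpM2l// ltW.
      have := vM y Dy; move: M'2; rewrite mulrBr mulr1; lra.
    have by_ := clb _ clDy nDy; rewrite bv//.
    have ME : M' * E y <= M' by rewrite -[leRHS]mulr1 ler_wpM2l ?E1// ltW.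
    have [yp|yp] := ltP `|y - p| (rho * eps).
      have : 0 <= K * i ^+ 2 * sqdist p y.
        rewrite mulr_ge0//; last by apply: le_trans (sqr_norm_le_dotmul _); exact: sqr_ge0.
        by rewrite mulr_ge0 ?sqr_ge0// ltW.
      have := phip _ by_ yp; lra.
    have : M + 2 * delta <= K * i ^+ 2 * sqdist p y.
      have : (rho * eps) ^+ 2 <= sqdist p y.
        apply: le_trans (sqr_norm_le_dotmul _); rewrite ler_sqr ?nnegrE//.
        by rewrite mulr_ge0// ltW.
      have Ki0 : 0 <= K * i ^+ 2 by rewrite mulr_ge0 ?sqr_ge0// ltW.
      move=> /(ler_wpM2l Ki0).
      apply: le_trans; rewrite /K.
      have -> : (M + 2 * delta) / rho ^+ 2 * i ^+ 2 * (rho * eps) ^+ 2 =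
        (M + 2 * delta) * (eps * i) ^+ 2.
        by field; rewrite gt_eqF.
      by rewrite ei expr1n mulr1.
    have := phiM _ by_; lra.
have nuxp : dotmul nu x - c <= dR * (r0 * eps).
  rewrite -nup -dotmulBr (le_trans (ler_norm _))// -[r0 * eps]mul1r.
  apply: dotmul_le => j; first exact: unit_vector_coord.
  exact: le_trans (coord_le_norm _ _) xp.
have r0d1 : dR * r0 < 1.
  by move: r0d; rewrite mulrDr mulr1 [r0 * _]mulrC; lra.
have r01 : r0 <= 1.
  have : 0 <= r0 * dR by rewrite mulr_ge0// ltW.
  by move: r0d; rewrite mulrDr mulr1; lra.
have Ux : U x.
  split => //=; rewrite -ltrBlDl (le_lt_trans nuxp)// mulrA.
  by rewrite gtr_pMl.
have Q : i ^+ 2 * sqdist p x <= dR * r0.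
  have : sqdist p x <= dR * (r0 * eps * (r0 * eps)).
    rewrite (le_trans (ler_norm _))//.
    by apply: dotmul_le => j; exact: le_trans (coord_le_norm _ _) xp.
  move=> /(ler_wpM2l (sqr_ge0 i)) Qx.
  rewrite (le_trans Qx)//.
  have -> : i ^+ 2 * (dR * (r0 * eps * (r0 * eps))) = dR * (r0 * r0) * (eps * i) ^+ 2.
    by ring.
  by rewrite ei expr1n mulr1 ler_wpM2l// ler_piMl// ltW.
have Ex : 1 - l * (dR * r0) <= E x.
  rewrite (le_trans _ (expR_ge1Dx _))// lerD2l mulNr lerN2 -mulrA (ler_wpM2l (ltW l0))//.
  rewrite -(@ler_pM2l _ eps)// mulrA ei mul1r mulrC -mulrA.
  by rewrite (le_trans nuxp).
have := fU x Ux; rewrite /f /cst.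
have : K * (i ^+ 2 * sqdist p x) <= K * (dR * r0) by rewrite ler_wpM2l// ltW.
have : M' * (1 - l * (dR * r0)) <= M' * E x by rewrite ler_wpM2l// ltW.
move: r0K.
have -> : r0 * ((K + M' * l) * dR) = K * (dR * r0) + M' * (l * (dR * r0)) by ring.
rewrite mulrBr mulr1 mulrA; lra.
Qed.

End barrier.
End dirichlet_problem.

Section polygon_face.
Context {R : realType} {d : nat}.
Local Notation V := 'rV[R]_d.

Lemma polygon_face N (nu : 'I_N -> V) (c : 'I_N -> R) : (0 < d)%N ->
  polygon nu c !=set0 -> bounded_set (polygon nu c) ->
  exists j (z : V) (r : R), [/\ 0 < r, dotmul (nu j) z = c j &
    forall x, `|x - z| < r -> c j < dotmul (nu j) x -> polygon nu c x].
Proof.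
move=> d0 [x0 Dx0] bD.
pose P (J : {set 'I_N}) := `[< forall x, (forall j, j \in J -> c j < dotmul (nu j) x) ->
  polygon nu c x >].
have PT : P (finset.setTfor 'I_N) by apply/asboolP => x cx j; exact: cx.
have [J /asboolP PJ Jmin] := @arg_minnP _ (finset.setTfor 'I_N) P (fun J => #|J|) PT.
have [J0|[j jJ]] := set_0Vmem J.
  case: bD => M [Mr DM]; have DT x : polygon nu c x.
    by apply: PJ => j; rewrite J0 inE.
  have := DM (`|M| + 1) _ (const_mx (`|M| + 2)) (DT _).
  rewrite (le_lt_trans (ler_norm _)) ?ltrDl// => /(_ isT).
  have := @coord_le_norm R d (const_mx (`|M| + 2)) (Ordinal d0); rewrite mxE => h1 h2.
  have := le_trans (ler_norm _) (le_trans h1 h2); lra.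
have : ~~ P (J :\ j).
  by apply/negP => /Jmin; rewrite leqNgt (cardsD1 j J) jJ ltnS leqnn.
rewrite /P => /asboolPn /existsNP[z /not_implyP[zJ nDz]].
have zj : dotmul (nu j) z <= c j.
  rewrite leNgt; apply/negP => czj; apply: nDz; apply: PJ => i iJ.
  by have [->//|ij] := eqVneq i j; apply: zJ; rewrite !inE ij.
have x0j := Dx0 j.
pose t := (c j - dotmul (nu j) z) / (dotmul (nu j) x0 - dotmul (nu j) z).
have den0 : 0 < dotmul (nu j) x0 - dotmul (nu j) z by lra.
have t0 : 0 <= t by apply: divr_ge0; [rewrite subr_ge0|exact: ltW].
have t1 : t < 1 by rewrite ltr_pdivrMr// mul1r; lra.
pose z' := z + t *: (x0 - z).
have z'i i : dotmul (nu i) z' = (1 - t) * dotmul (nu i) z + t * dotmul (nu i) x0.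
  by rewrite dotmulDr dotmulZr dotmulBr; ring.
have z'J i : i \in J -> i != j -> c i < dotmul (nu i) z'.
  move=> iJ ij; rewrite z'i.
  have h1 : c i < dotmul (nu i) z by apply: zJ; rewrite !inE ij.
  have h2 : 0 <= t * (dotmul (nu i) x0 - c i) by rewrite mulr_ge0// subr_ge0 ltW.
  have h3 : 0 < (1 - t) * (dotmul (nu i) z - c i) by rewrite mulr_gt0 ?subr_gt0.
  lra.
have : \forall x \near z', forall i, i \in J -> i != j -> c i < dotmul (nu i) x.
  apply: (@filter_forall V 'I_N
    (fun i x => i \in J -> i != j -> c i < dotmul (nu i) x) _ (nbhs_filter z')) => i.
  have [iJ|/negP niJ] := boolP (i \in J); last by apply: nearW.
  have [->|ij] := eqVneq i j; first by apply: nearW.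
  have := @dotmul_cont R d (nu i) z' => /cvgr_gt /(_ _ (z'J i iJ ij)).
  by apply: filterS => x + _ _.
move=> /nbhs_ballP[r /= r0 rz']; exists j, z', r; split => //.
  by rewrite z'i; rewrite /t; field; rewrite gt_eqF.
move=> x xz' cx; apply: PJ => i iJ; have [->//|ij] := eqVneq i j.
by apply: (rz' x) => //; rewrite -ball_normE/= distrC.
Qed.

End polygon_face.

Section hyperplane_density.
Context {R : realType} {d : nat}.
Local Notation V := 'rV[R]_d.
Local Notation intv m := (map_mx intr m : V).
Implicit Types (m : 'rV[int]_d) (nu : V).

Lemma dotmulDl (x y z : V) : dotmul (x + y) z = dotmul x z + dotmul y z.
Proof. by rewrite !(dotmulC _ z) dotmulDr. Qed.

Lemma diophantine_neq0 nu m : diophantine nu -> m != 0 ->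
  dotmul (intv m) nu != 0.
Proof.
move=> [tau [C [_ C0 H]]] /H; apply: contraTneq => ->.
by rewrite normr0 -leNgt mulr_ge0 ?powR_ge0// ltW.
Qed.

(* If the integer combinations of the entries were bounded away from 0, they
   would all be multiples of one of them, and the entries commensurable. *)
Lemma small_integer_combination nu (rho : R) : (2 <= d)%N ->
  (forall m, m != 0 -> dotmul (intv m) nu != 0) -> 0 < rho ->
  exists m, 0 < dotmul (intv m) nu < rho.
Proof.
move=> d2 nu0 rho0; apply: contrapT => nex.
pose g m := dotmul (intv m) nu.
have gB m1 m2 : g (m1 - m2) = g m1 - g m2.
  by rewrite /g map_mxB dotmulDl -scaleN1r !(dotmulC _ nu) dotmulZr mulN1r.
have gZ (k : int) m : g (k *: m) = k%:~R * g m.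
  by rewrite /g map_mxZ dotmulC dotmulZr dotmulC.
have grho m : 0 < g m -> rho <= g m.
  by move=> gm0; rewrite leNgt; apply/negP => gmr; apply: nex; exists m; rewrite gm0.
pose i0 := Ordinal (ltnW d2); pose i1 := Ordinal d2.
pose u0 : 'rV[int]_d := delta_mx 0 i0; pose u1 : 'rV[int]_d := delta_mx 0 i1.
have u00 : u0 != 0.
  by apply/eqP => /rowP/(_ i0); rewrite !mxE !eqxx.
pose S : set R := [set x | 0 < x /\ exists m, x = g m].
have hiS : has_inf S.
  split; last by exists 0 => x [/ltW].
  have := nu0 u0 u00; rewrite -/(g u0) neq_lt => /orP[gu|gu]; last first.
    by exists (g u0); split; [|exists u0].
  exists (- g u0); split; first by rewrite oppr_gt0.
  by exists (0 - u0); rewrite gB -(subrr u0) gB subrr sub0r.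
have [a [a0 [ma aE]] a_inf] := inf_adherent rho0 hiS.
have mult m : exists k : int, g m = k%:~R * a.
  exists (Num.floor (g m / a)); set k := Num.floor _.
  have /andP[k1 k2] := floor_itv (g m / a); rewrite -/k in k1 k2.
  rewrite ler_pdivlMr// in k1; rewrite ltr_pdivrMr// intrD mulrDl mul1r in k2.
  have rE : g (m - k *: ma) = g m - k%:~R * a by rewrite gB gZ -aE.
  apply/eqP; rewrite -subr_eq0 -rE; apply: contraT => r_neq0.
  have r0 : 0 < g (m - k *: ma) by rewrite lt0r r_neq0 rE subr_ge0.
  have infr : inf S <= g (m - k *: ma).
    by apply: ge_inf; [exact: hiS.2|split => //; exists (m - k *: ma)].
  have : rho <= g (ma - (m - k *: ma)).
    by apply: grho; rewrite gB -aE rE; lra.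
  by rewrite gB -aE; lra.
have [k0 k0E] := mult u0; have [k1 k1E] := mult u1.
have k00 : k0 != 0.
  apply/eqP => k00; have := nu0 u0 u00.
  by rewrite -/(g u0) k0E k00 mul0r eqxx.
have := nu0 (k1 *: u0 - k0 *: u1).
rewrite -/(g _) gB !gZ k0E k1E mulrCA subrr eqxx => H.
suff /H : k1 *: u0 - k0 *: u1 != 0 by [].
apply/eqP => /rowP/(_ i1); rewrite !mxE !eqxx/= mulr0 mulr1 sub0r => /eqP.
by rewrite oppr_eq0 (negbTE k00).
Qed.

Lemma dense_hyperplanes nu y (rho : R) : unit_vector nu ->
  (forall r : R, 0 < r -> exists m, 0 < dotmul (intv m) nu < r) -> 0 < rho ->
  exists2 R0 : R, 0 <= R0 & forall z : V, exists m (p : V),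
    [/\ dotmul nu p = dotmul nu z, `|p - z| <= R0 & `|p - (y + intv m)| < rho].
Proof.
move=> nu1 nud rho0; have [m1 /andP[th0 thr]] := nud _ rho0.
set th := dotmul _ _ in th0 thr.
have nun : `|nu| <= 1.
  by apply: rV_norm_le => // i; exact: unit_vector_coord.
exists (((d%:R / th) + 1) * `|intv m1 : V| + 1 + rho).
  by rewrite !addr_ge0 ?mulr_ge0 ?addr_ge0 ?divr_ge0// ltW.
move=> z.
pose m0 : 'rV[int]_d := \row_i Num.floor ((z - y) 0 i).
pose w : V := z - y - intv m0.
have w01 i : 0 <= w 0 i < 1.
  rewrite !mxE; have := floor_itv ((z - y) 0 i); rewrite !mxE intrD => /andP[].
  by move=> ? ?; apply/andP; split; lra.
have wn : `|w| <= 1.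
  apply: rV_norm_le => // i; have /andP[w0 w1] := w01 i.
  by rewrite ger0_norm// ltW.
pose tau := dotmul nu w.
have taud : `|tau| <= d%:R.
  rewrite -[d%:R]mulr1 -[X in _ * X](mulr1 1); apply: dotmul_le => i.
    exact: unit_vector_coord.
  exact: le_trans (coord_le_norm _ _) wn.
pose k := Num.floor (tau / th).
have /andP[k1 k2] := floor_itv (tau / th); rewrite -/k in k1 k2.
pose s := tau - k%:~R * th.
have s0 : 0 <= s by rewrite subr_ge0 -ler_pdivlMr.
have s1 : s < th.
  by move: k2; rewrite ltr_pdivrMr// intrD mulrDl mul1r /s; lra.
have sn : `|s *: nu| < rho.
  rewrite normrZ ger0_norm// (le_lt_trans _ thr)// (le_trans _ (ltW s1))//.
  by rewrite -[leRHS]mulr1 ler_wpM2l.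
exists (m0 + k *: m1), (y + intv (m0 + k *: m1) + s *: nu).
have mE : intv (m0 + k *: m1) = intv m0 + k%:~R *: intv m1 :> V.
  by rewrite map_mxD map_mxZ.
split.
- rewrite mE !dotmulDr !dotmulZr nu1 mulr1 [dotmul nu (intv m1)]dotmulC -/th.
  have -> : z = y + intv m0 + w by apply/rowP => i; rewrite /w !mxE; ring.
  by rewrite (dotmulDr _ (y + _) w) (dotmulDr _ y) /s /tau; ring.
- have -> : y + intv (m0 + k *: m1) + s *: nu - z = (k%:~R *: intv m1 - w) + s *: nu.
    by rewrite mE /w; apply/rowP => i; rewrite !mxE; ring.
  rewrite (le_trans (ler_normD _ _))// lerD//; last exact: ltW.
  rewrite (le_trans (ler_normB _ _))// lerD// normrZ ler_wpM2r//.
  have tth : `|tau / th| <= d%:R / th.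
    by rewrite normrM normfV (gtr0_norm th0) ler_wpM2r// invr_ge0 ltW.
  move: tth; rewrite !ler_norml => /andP[t1 t2].
  by rewrite intrD in k2; apply/andP; split; lra.
- by rewrite addrC addKr.
Qed.

End hyperplane_density.

Section cube_measure.
Context {R : realType}.
Local Notation RT := (measurableTypeR R).

Definition tcube n (q : 'I_n -> R) (h : R) : set (n.-tuple RT) :=
  [set t | forall i, `|tnth t i - q i| < h].

Lemma measurable_tcube n (q : 'I_n -> R) h : measurable (tcube q h).
Proof.
have -> : tcube q h = \bigcap_(i in [set: 'I_n]) ((fun t => tnth t i) @^-1` (ball (q i) h)).
  apply/seteqP; split => t /= H i; last by rewrite distrC; exact: (H i I).
  by move=> _; rewrite /= /ball/= distrC; exact: H.
apply: fin_bigcap_measurable; first exact: finite_finset.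
move=> i _; rewrite -[X in measurable X]setTI.
apply: (@measurable_tnth _ RT n i) => //.
by rewrite ball_itv; exact: measurable_itv.
Qed.

Lemma lebesgue_tcube n (q : 'I_n -> R) h : 0 <= h ->
  lebesgue_tuple R n (tcube q h) = ((h *+ 2) ^+ n)%:E.
Proof.
move=> h0; elim: n q => [|n IH] q.
  by rewrite /= diracE mem_set// => -[].
rewrite /= /cons_measure /pushforward.
have -> : @cons_pair R n @^-1` tcube q h =
    ball (q ord0) h `*` tcube (fun i => q (lift ord0 i)) h.
  apply/seteqP; split => -[x t] /=.
    move=> H; split; first by have := H ord0; rewrite (tnth_nth 0)/= distrC.
    by move=> i; have := H (lift ord0 i); rewrite !(tnth_nth 0)/=.
  move=> [xq tq] i; case: (unliftP ord0 i) => [j|] ->.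
    by have := tq j; rewrite !(tnth_nth 0)/=.
  by rewrite (tnth_nth 0)/= distrC.
rewrite product_measure1E; last 2 first.
- by rewrite ball_itv; exact: measurable_itv.
- exact: measurable_tcube.
by rewrite exprS EFinM; congr (_ * _)%E; [exact: lebesgue_measure_ball|exact: IH].
Qed.

Lemma lebesgue_disjoint_tcubes n (K : finType) (q : K -> 'I_n -> R) h : 0 <= h ->
  (forall k k', k != k' -> exists i, h *+ 2 <= `|q k i - q k' i|) ->
  exists E : set (n.-tuple RT), [/\ measurable E,
    forall t, E t -> exists k, tcube (q k) h t &
    lebesgue_tuple R n E = (#|K|%:R * (h *+ 2) ^+ n)%:E].
Proof.
move=> h0 qsep; exists (\bigcup_(k in [set` enum K]) tcube (q k) h); split.
- apply: fin_bigcup_measurable; first exact: finite_finset.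
  by move=> k _; exact: measurable_tcube.
- by move=> t [k _ kt]; exists k.
rewrite measure_fin_bigcup; last 3 first.
- exact: finite_finset.
- apply/trivIsetP => k k' _ _ /qsep[i iq].
  rewrite -subset0 => t [/(_ i) tk /(_ i) tk']; move: iq; rewrite leNgt => /negP; apply.
  rewrite -(subrK (tnth t i) (q k i)) -addrA (le_lt_trans (ler_normD _ _))//.
  by rewrite mulr2n ltrD// distrC.
- by move=> k _; exact: measurable_tcube.
rewrite (eq_fsbigr (fun=> ((h *+ 2) ^+ n)%:E)); last first.
  by move=> k _; exact: lebesgue_tcube.
rewrite -fsbig_seq ?enum_uniq// big_enum sumEFin/= sumr_const.
by rewrite mulr_natl.
Qed.

End cube_measure.

Section Lnorm_lower_bound.
Context d (T : measurableType d) (R : realType) (mu : {measure set T -> \bar R}).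
Import HBNNSimple.

(* The integral of a nonnegative function is a supremum over the simple
   functions below it, so [f] need not be measurable. *)
Lemma integral_ge_indic (f : T -> \bar R) (E : set T) (a : R) : measurable E ->
  0 <= a -> (forall x, 0 <= f x)%E -> (forall x, E x -> a%:E <= f x)%E ->
  (a%:E * mu E <= \int[mu]_x f x)%E.
Proof.
move=> mE a0 f0 fa; pose h := scale_nnsfun (indic_nnsfun R mE) a0.
have -> : (a%:E * mu E = \int[mu]_x (EFin \o h) x)%E.
  under eq_integral do rewrite /h/= EFinM.
  rewrite ge0_integralZl_EFin//; last 2 first.
  - by move=> x _; rewrite lee_fin.
  - by apply/measurable_EFinP; exact: measurable_indic.
  by rewrite integral_indic// setIT.
rewrite integralT_nnsfun ge0_integralTE//.
apply: ereal_sup_ubound; exists h => // x.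
rewrite /h/= mindicE; have [xE|xE] := boolP (x \in E).
  by rewrite mulr1; apply: fa; rewrite inE in xE.
by rewrite mulr0.
Qed.

Lemma Lnorm_ge (f : T -> \bar R) (E : set T) (a m p : R) : measurable E ->
  0 <= a -> 1 <= p -> 0 <= m -> (m%:E <= mu E)%E ->
  (forall x, E x -> a%:E <= f x)%E ->
  ((a * m `^ p^-1)%:E <= Lnorm mu p%:E f)%E.
Proof.
move=> mE a0 p1 m0 mmu fa; have p0 : 0 < p by rewrite (lt_le_trans _ p1).
have pV0 : 0 <= p^-1 by rewrite invr_ge0 ltW.
have I : ((a `^ p * m)%:E <= \int[mu]_x `|f x| `^ p)%E.
  rewrite EFinM (le_trans (lee_wpmul2l _ mmu)) ?lee_fin ?powR_ge0//.
  apply: integral_ge_indic => // [|x|x Ex]; first exact: powR_ge0.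
    exact: poweR_ge0.
  rewrite -poweR_EFin; apply: gt0_ler_poweR; first exact: ltW.
  - by rewrite in_itv/= leey andbT lee_fin.
  - by rewrite in_itv/= leey andbT.
  - exact: le_trans (fa x Ex) (lee_abs _).
rewrite unlock.
have -> : (a * m `^ p^-1)%:E = ((a `^ p * m)%:E `^ p^-1)%E.
  rewrite poweR_EFin powRM ?powR_ge0// -powRrM mulfV ?gt_eqF//.
  by rewrite powRr1.
apply: gt0_ler_poweR I => //; rewrite in_itv/= leey andbT.
  by rewrite lee_fin mulr_ge0// powR_ge0.
by apply: integral_ge0 => x _; exact: poweR_ge0.
Qed.
End Lnorm_lower_bound.

Section packing.
Context {R : realType} {d' : nat}.
Local Notation d := d'.+1.
Local Notation V := 'rV[R]_d.

Implicit Types (nu : V).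

Definition hyperplane_lattice (nu : V) n (k : {ffun 'I_d' -> 'I_n}) : V :=
  \row_l (if unlift ord0 l is Some j then (k j)%:R
          else - (\sum_j nu 0 (lift ord0 j) * (k j)%:R) / nu 0 ord0).

Lemma hyperplane_lattice_orth nu n (k : {ffun 'I_d' -> 'I_n}) :
  nu 0 ord0 != 0 -> dotmul nu (hyperplane_lattice nu k) = 0.
Proof.
move=> nu0; rewrite /dotmul big_ord_recl mxE unlift_none mulrC divfK//.
apply/eqP; rewrite addrC subr_eq0; apply/eqP; apply: eq_bigr => j _.
by rewrite mxE liftK.
Qed.

Lemma hyperplane_lattice_norm nu n (k : {ffun 'I_d' -> 'I_n}) : unit_vector nu ->
  nu 0 ord0 != 0 ->
  `|hyperplane_lattice nu k| <= n%:R * (1 + d'%:R / `|nu 0 ord0|).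
Proof.
move=> nu1 nu0; have kn j : `|(k j)%:R : R| <= n%:R.
  by rewrite ger0_norm// ler_nat ltnW.
have L0 : 0 <= d'%:R / `|nu 0 ord0| by rewrite divr_ge0.
apply: rV_norm_le => [|i]; first by rewrite mulr_ge0// addr_ge0.
rewrite mxE; case: unliftP => [j _|_].
  by rewrite (le_trans (kn j))// ler_peMr// lerDl.
rewrite normrM normrN normfV mulrDr mulr1 ler_wpDl// mulrA ler_wpM2r ?invr_ge0//.
rewrite [leRHS]mulrC -[n%:R]mul1r; apply: dotmul_le => // j.
exact: unit_vector_coord.
Qed.

Lemma hyperplane_packing (nu z : V) (c r r0 R0 : R) (Q : V -> Prop) :
  unit_vector nu -> nu 0 ord0 != 0 -> dotmul nu z = c ->
  0 < r -> 0 < r0 -> 0 <= R0 ->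
  (forall y, exists p, [/\ dotmul nu p = dotmul nu y, `|p - y| <= R0 & Q p]) ->
  exists eps0 c0 : R, [/\ 0 < eps0, 0 < c0 & forall eps, 0 < eps < eps0 ->
    exists E, [/\ measurable E, ((c0 * eps)%:E <= lebesgue_tuple R d E)%E &
    forall t, E t -> exists p, let x := row_of_tuple t in
      [/\ Q p, dotmul nu (eps *: p) = c, `|eps *: p - z| <= r &
       [/\ `|x - eps *: p| <= r0 * eps, `|x - z| < r & c < dotmul nu x]]]].
Proof.
move=> nu1 nu0 nuz rpos r0pos R00 HQ.
pose L : R := 1 + d'%:R / `|nu 0 ord0|.
have L0 : 0 < L by rewrite ltr_wpDr// divr_ge0.
pose R1 : R := (r0 + R0) *+ 2 + 1.
have rR0 : 0 < r0 + R0 by rewrite ltr_wpDr.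
have R10 : 0 < R1 by rewrite addr_gt0// pmulrn_lgt0.
pose kap : R := r0 / (4 * d%:R).
have kap0 : 0 < kap by rewrite divr_gt0// mulr_gt0// ltr0n.
have kapd : d%:R * kap = r0 / 4 by rewrite /kap; field; rewrite addrC natr1 pnatr_eq0.
have kapr : kap <= r0 / 4.
  by rewrite -kapd ler_peMl ?ler1n// ltW.
pose eta : R := r / (2 * (R1 * L)).
have eta0 : 0 < eta by rewrite divr_gt0// !mulr_gt0.
have etaE : R1 * L * eta = r / 2 by rewrite /eta; field; rewrite !gt_eqF.
exists (Num.min (r / (2 * (r0 + R0))) (eta / 2)), ((eta / 2) ^+ d' * (kap *+ 2) ^+ d).
split.
- rewrite lt_min; apply/andP; split; last exact: divr_gt0.
  by apply: divr_gt0 => //; exact: mulr_gt0.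
- apply: mulr_gt0; apply: exprn_gt0; first exact: divr_gt0.
  by rewrite pmulrn_lgt0.
move=> eps /andP[eps0]; rewrite lt_min ltr_pdivlMr ?mulr_gt0// => /andP[eps1 eps2].
pose i := eps^-1.
have i0 : 0 < i by rewrite invr_gt0.
have ei : eps * i = 1 by rewrite mulfV// gt_eqF.
pose n := Num.truncn (eta * i).
have /andP[n1 n2] : n%:R <= eta * i < n.+1%:R.
  by apply: truncn_itv; rewrite mulr_ge0// ltW.
have nlow : eta / 2 * i <= n%:R.
  have : 1 <= eta / 2 * i by rewrite ler_pdivlMr// mul1r ltW.
  move: n2; rewrite -natr1; lra.
pose T k := @hyperplane_lattice nu n k.
pose b k := z + (eps * R1) *: T k.
have nub k : dotmul nu (b k) = c.
  by rewrite dotmulDr dotmulZr hyperplane_lattice_orth// mulr0 addr0.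
have bz k : `|b k - z| <= r / 2.
  rewrite /b addrC addKr normrZ ger0_norm; last by rewrite mulr_ge0// ltW.
  rewrite (le_trans (ler_wpM2l _ (hyperplane_lattice_norm k nu1 nu0)))//.
    by rewrite mulr_ge0// ltW.
  have : eps * R1 * (n%:R * L) <= eps * R1 * (eta * i * L).
    by rewrite ler_wpM2l ?ler_wpM2r// ?mulr_ge0// ltW.
  move/le_trans; apply.
  have -> : eps * R1 * (eta * i * L) = R1 * L * eta * (eps * i) by ring.
  by rewrite ei mulr1 etaE.
have [P HP] := choice (fun k => HQ (i *: b k)).
have Pb k : `|eps *: P k - b k| <= eps * R0.
  have [_ h _] := HP k.
  have -> : eps *: P k - b k = eps *: (P k - i *: b k).
    by rewrite scalerBr scalerA ei scale1r.
  by rewrite normrZ gtr0_norm// ler_wpM2l// ltW.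
pose ctr k : V := eps *: P k + (r0 / 2 * eps) *: nu.
have [||E [mE EK muE]] := @lebesgue_disjoint_tcubes R d {ffun 'I_d' -> 'I_n}
    (fun k l => ctr k 0 l) (kap * eps).
- by rewrite mulr_ge0// ltW.
- move=> k k' kk'.
  have [j kj] : exists j, k j != k' j.
    apply/existsP; apply: contraNT kk' => /existsPn H.
    by apply/eqP/ffunP => j; apply/eqP; have := H j; rewrite negbK.
  exists (lift ord0 j).
  have bE : b k 0 (lift ord0 j) - b k' 0 (lift ord0 j) =
      eps * R1 * ((k j)%:R - (k' j)%:R).
    by rewrite !mxE liftK; ring.
  have kk1 : 1 <= `|(k j)%:R - (k' j)%:R : R|.
    move: kj; rewrite -val_eqE/= neq_ltn => /orP[|]; rewrite -(ler_nat R) -natr1.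
      by move=> h; rewrite ler_normr; apply/orP; right; lra.
    by move=> h; rewrite ler_normr; apply/orP; left; lra.
  have bb : eps * R1 <= `|b k 0 (lift ord0 j) - b k' 0 (lift ord0 j)|.
    rewrite bE normrM gtr0_norm ?mulr_gt0// ler_peMr// mulr_ge0// ltW//.
  have PbE k0 l : `|eps * P k0 0 l - b k0 0 l| <= eps * R0.
    have := le_trans (coord_le_norm (eps *: P k0 - b k0) l) (Pb k0).
    by rewrite mxE [(eps *: P k0) 0 l]mxE [(- b k0) 0 l]mxE.
  have ctrE k0 l : ctr k0 0 l = eps * P k0 0 l + r0 / 2 * eps * nu 0 l.
    by rewrite /ctr mxE [(eps *: P k0) 0 l]mxE [((r0 / 2 * eps) *: nu) 0 l]mxE.
  rewrite !ctrE; move: bb (PbE k (lift ord0 j)) (PbE k' (lift ord0 j)).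
  set u := P k 0 _; set u' := P k' 0 _; set w := b k 0 _.
  set w' := b k' 0 _; set s := _ * nu 0 _ => bb h1 h2.
  have -> : eps * u + s - (eps * u' + s) = (w - w') + ((eps * u - w) - (eps * u' - w')).
    by ring.
  apply: le_trans (lerB_normD _ _).
  have h3 := le_trans (ler_normB _ _) (lerD h1 h2).
  have : kap * eps <= r0 / 4 * eps by rewrite ler_wpM2r// ltW.
  have : 0 < r0 * eps by rewrite mulr_gt0.
  move: bb h3; rewrite /R1; lra.
exists E; split => //.
- rewrite muE lee_fin card_ffun !card_ord natrX.
  have -> : (eta / 2) ^+ d' * (kap *+ 2) ^+ d * eps =
     (eta / 2 * i) ^+ d' * ((kap * eps) *+ 2) ^+ d.
    rewrite -mulrnAl [(_ * i) ^+ _]exprMn [(_ * eps) ^+ _]exprMn [eps ^+ _]exprS.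
    have XY : eps ^+ d' * i ^+ d' = 1 by rewrite -exprMn ei expr1n.
    by rewrite -[LHS]mulr1 -[X in _ * X = _]XY; ring.
  rewrite ler_wpM2r//; first by rewrite exprn_ge0// mulrn_wge0// mulr_ge0// ltW.
  by rewrite lerXn2r// nnegrE// mulr_ge0// ltW// divr_gt0.
- move=> t /EK[k tk]; exists (P k) => x.
  have [nuP _ QP] := HP k.
  have nuPc : dotmul nu (eps *: P k) = c.
    by rewrite dotmulZr nuP dotmulZr mulrA ei mul1r.
  have xq l : `|(x - ctr k) 0 l| <= kap * eps.
    by have := tk l; rewrite !mxE => /ltW.
  have xctr : `|x - ctr k| <= kap * eps.
    by apply: rV_norm_le => //; rewrite mulr_ge0// ltW.
  have nun : `|nu| <= 1.
    by apply: rV_norm_le => // l; exact: unit_vector_coord.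
  have xP : `|x - eps *: P k| <= r0 * eps.
    have -> : x - eps *: P k = (x - ctr k) + (r0 / 2 * eps) *: nu.
      by rewrite /ctr opprD addrA subrK.
    rewrite (le_trans (ler_normD _ _))// normrZ.
    rewrite gtr0_norm; last by rewrite !mulr_gt0.
    have : r0 / 2 * eps * `|nu| <= r0 / 2 * eps.
      by rewrite ler_piMr// !mulr_ge0// ltW.
    have : kap * eps <= r0 / 4 * eps by rewrite ler_wpM2r// ltW.
    have : 0 < r0 * eps by rewrite mulr_gt0.
    lra.
  have rr : (r0 + R0) * eps < r / 2 by lra.
  have Pz : `|eps *: P k - z| <= eps * R0 + r / 2.
    by rewrite -(subrK (b k) (eps *: P k)) -addrA (le_trans (ler_normD _ _))// lerD.
  have re0 : 0 < r0 * eps by rewrite mulr_gt0.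
  split => //; first by lra.
  split => //.
  - rewrite -(subrK (eps *: P k) x) -addrA (le_lt_trans (ler_normD _ _))//; lra.
  - have -> : dotmul nu x = dotmul nu (x - ctr k) + dotmul nu (ctr k).
      by rewrite -dotmulDr subrK.
    have -> : dotmul nu (ctr k) = c + r0 / 2 * eps.
      by rewrite /ctr dotmulDr nuPc dotmulZr nu1 mulr1.
    have : `|dotmul nu (x - ctr k)| <= d%:R * (1 * (kap * eps)).
      by apply: dotmul_le => // l; exact: unit_vector_coord.
    rewrite mul1r mulrA kapd ler_norml => /andP[h _].
    lra.
Qed.

End packing.

Section boundary_layer.
Context {R : realType} {d : nat}.
Local Notation V := 'rV[R]_d.
Implicit Types (D : set V) (A : V -> 'M[R]_d) (f v : V -> R).

Definition periodic f : Prop :=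
  forall (x : V) (m : 'rV[int]_d), f (x + map_mx intr m) = f x.

Lemma periodic_bounded f : periodic f -> continuous f ->
  exists2 M : R, 0 <= M & forall x, `|f x| <= M.
Proof.
move=> pf cf.
have [||B fB] := @continuous_bounded R d [set x : V | `|x| <= 1] f => //.
  by exists 1; split => // r r1 x /= x1; rewrite (le_trans x1)// ltW.
exists `|B| => // x.
pose m : 'rV[int]_d := \row_i Num.floor (x 0 i).
rewrite -(subrK (map_mx intr m) x) pf (le_trans _ (ler_norm B))// fB//=.
apply: rV_norm_le => // i; rewrite !mxE.
have /andP[h1 h2] := floor_itv (x 0 i); rewrite intrD in h2.
by rewrite ler_norml; apply/andP; split; lra.
Qed.

Lemma polygon_open N (nu : 'I_N -> V) (c : 'I_N -> R) : open (polygon nu c).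
Proof.
rewrite openE => x Dx.
apply: (@filter_forall V 'I_N (fun j y => c j < dotmul (nu j) y) _ (nbhs_filter x)) => j.
by have := @dotmul_cont R d (nu j) x => /cvgr_gt /(_ _ (Dx j)).
Qed.

End boundary_layer.

Section boundary_layer_succ.
Context {R : realType} {d' : nat}.
Local Notation d := d'.+1.
Local Notation V := 'rV[R]_d.
Implicit Types (D : set V) (A : V -> 'M[R]_d) (f v : V -> R).

Lemma boundary_layer D A f (y : V) : (2 <= d)%N ->
  diophantine_polygonal_domain D -> uniformly_elliptic A ->
  (forall i j, Ck 1 setT (fun x => A x i j)) ->
  periodic f -> continuous f -> 0 < f y ->
  exists eps0 c0 delta : R, [/\ 0 < eps0, 0 < c0, 0 < delta &
  forall eps v, 0 < eps < eps0 ->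
    nondiv_solution A D (fun x => f (eps^-1 *: x)) v ->
    exists E, [/\ measurable E, ((c0 * eps)%:E <= lebesgue_tuple R d E)%E &
      forall t, E t -> D (row_of_tuple t) /\ delta <= v (row_of_tuple t)]].
Proof.
move=> d2 [N [nu [c [nu1 nuD DE D0 bD]]]] [cA [cA0 ellA]] A1 pf cf fy.
have [j [z [r [r0 nuz Dz]]]] : exists j (z : V) (r : R),
    [/\ 0 < r, dotmul (nu j) z = c j &
    forall x, `|x - z| < r -> c j < dotmul (nu j) x -> D x].
  by move: D0 bD; rewrite DE; apply: polygon_face; exact: ltnW.
have oD : open D by rewrite DE; exact: polygon_open.
have Dj x : D x -> c j < dotmul (nu j) x by rewrite DE.
have [B dB] := drift_bounded bD A1.
have [S1 [S1r DS1]] := bounded_closure bD.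
pose S := `|S1| + 1 + (`|z| + r).
have S0 : 0 <= S by rewrite !addr_ge0// ltW.
have DS x : closure D x -> `|x| <= S.
  move=> /(DS1 (`|S1| + 1)) h; rewrite (le_trans (h _))//.
    by rewrite (le_lt_trans (ler_norm _))// ltrDl.
  by rewrite lerDl addr_ge0// ltW.
have trA x : \tr (A x) <= d%:R * cA.
  have -> : d%:R * cA = \sum_(i < d) cA by rewrite sumr_const card_ord mulr_natl.
  apply: ler_sum => i _.
  rewrite -qform_delta; have /andP[_] := ellA x (delta_mx 0 i).
  rewrite (_ : dotmul _ _ = 1) ?mulr1//.
  by rewrite (dotmul_basis (delta_mx 0 i)) mxE !eqxx.
have [M M0 fM] := periodic_bounded pf cf.
pose delta := f y / 4.
have delta0 : 0 < delta by rewrite divr_gt0.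
have /nbhs_ballP[rho /= rho0 frho] : \forall x \near y, 2 * delta < f x.
  by have := cf y => /cvgr_gt; apply; rewrite /delta; lra.
have rho20 : 0 < rho / 2 by rewrite divr_gt0.
have dB' x k : D x -> `|drift A x k| <= `|B|.
  by move=> Dx; rewrite (le_trans (dB x k Dx))// ler_norm.
have [r1 r10 lb] := @boundary_lower_bound R d D A (nu j) (c j) cA `|B| S oD bD (nu1 j)
  Dj cA0 (fun x xi => proj1 (andP (ellA x xi))) trA (normr_ge0 _) dB' S0 DS
  M delta (rho / 2) M0 delta0 rho20.
have nud := small_integer_combination d2
  (fun m => @diophantine_neq0 R d (nu j) m (nuD j)).
have [R0 R00 HR] := dense_hyperplanes y (nu1 j) nud rho20.
have nu0 : nu j 0 ord0 != 0.
  rewrite -dotmul_basis dotmulC.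
  rewrite (_ : basis_vector _ = map_mx intr (delta_mx 0 ord0 : 'rV[int]_d)).
    apply: diophantine_neq0 => //; apply/eqP => /rowP/(_ ord0).
    by rewrite !mxE !eqxx.
  by rewrite map_delta_mx.
have HQ y0 : exists p, [/\ dotmul (nu j) p = dotmul (nu j) y0, `|p - y0| <= R0 &
    exists m, `|p - (y + map_mx intr m)| < rho / 2].
  by have [m [p [h1 h2 h3]]] := HR y0; exists p; split => //; exists m.
have [eps1 [c0 [eps10 c00 HE]]] := hyperplane_packing (nu1 j) nu0 nuz r0 r10 R00 HQ.
exists (Num.min eps1 1), c0, delta; split => //.
  by rewrite lt_min eps10/=.
move=> eps v /andP[eps0]; rewrite lt_min => /andP[epslt1 eps1'] vsol.
have [|E [mE muE EP]] := HE eps; first by rewrite eps0.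
exists E; split => // t Et.
have [p [[m pm] nup pz [xp xz cx]]] := EP t Et.
have Dx : D (row_of_tuple t) by exact: Dz.
split => //.
apply: (lb eps _ v (eps *: p) _ nup _ _ _ vsol) => //.
- by rewrite eps0 ltW.
- rewrite -(subrK z (eps *: p)) (le_trans (ler_normD _ _))// /S.
  have : 0 <= `|S1| by []; lra.
- by move=> x _; have := fM (eps^-1 *: x); rewrite ler_norml => /andP[].
- move=> x _ xep; apply: ltW; rewrite -(subrK (map_mx intr m) (eps^-1 *: x)) pf.
  apply: frho; rewrite -ball_normE/= distrC.
  have -> : eps^-1 *: x - map_mx intr m - y =
      (eps^-1 *: (x - eps *: p)) + (p - (y + map_mx intr m)).
    rewrite scalerBr scalerA mulVf ?gt_eqF// scale1r opprD addrA addrA subrK.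
    by rewrite addrAC.
  rewrite (le_lt_trans (ler_normD _ _))// normrZ gtr0_norm ?invr_gt0//.
  have : eps^-1 * `|x - eps *: p| < rho / 2.
    by rewrite mulrC ltr_pdivrMr.
  by move: pm; lra.
Qed.

End boundary_layer_succ.

Section components.
Context {R : realType} {d : nat}.
Local Notation V := 'rV[R]_d.
Implicit Types (D : set V) (A : V -> 'M[R]_d) (phi u : V -> R[i]).

Lemma dirichlet_nondiv A D phi u : open D ->
  (forall i j, Ck 1 setT (fun x => A x i j)) -> dirichlet_solution A D phi u ->
  nondiv_solution A D (fun x => complex.Re (phi x)) (fun x => complex.Re (u x)) /\
  nondiv_solution A D (fun x => complex.Im (phi x)) (fun x => complex.Im (u x)).
Proof.
move=> oD A1 [[C1 C2] [c1 c2] [L1 L2] b].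
have key P v : Ck 2 D v -> {within closure D, continuous v} ->
    (forall x, D x -> divform A v x = 0) -> (forall x, boundary D x -> v x = P x) ->
    nondiv_solution A D P v.
  move=> Cv cv Lv bv; exists (fun i => 'D_(basis_vector i) v),
    (fun i j => 'D_(basis_vector j) ('D_(basis_vector i) v)); split => //.
    exact: Ck2_C2_on.
  move=> x Dx; have := Lv x Dx; rewrite (divform_nondiv oD Dx Cv A1).
  by move/eqP; rewrite oppr_eq0 => /eqP.
by split; apply: key => // x /b ->.
Qed.

End components.

Lemma Re_le_normc (R : realType) (w : R[i]) :
  `|complex.Re w| <= ComplexField.Normc.normc w.
Proof.
case: w => a b /=; rewrite -sqrtr_sqr ler_wsqrtr// lerDl; exact: sqr_ge0.
Qed.

Lemma Im_le_normc (R : realType) (w : R[i]) :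
  `|complex.Im w| <= ComplexField.Normc.normc w.
Proof.
case: w => a b /=; rewrite -sqrtr_sqr ler_wsqrtr// lerDr; exact: sqr_ge0.
Qed.

Lemma normc_le_add (R : realType) (w : R[i]) :
  ComplexField.Normc.normc w <= `|complex.Re w| + `|complex.Im w|.
Proof.
case: w => a b /=; rewrite -[leRHS]ger0_norm ?addr_ge0// -sqrtr_sqr ler_wsqrtr//.
rewrite -(real_normK (num_real a)) -(real_normK (num_real b)).
have : 0 <= `|a| * `|b| by rewrite mulr_ge0.
by rewrite sqrrD; lra.
Qed.

Lemma Ck_continuous (R : realType) d k (f : 'rV[R]_d -> R) :
  Ck k setT f -> continuous f.
Proof. by case: k => [|k] [cf _] x; exact: cf. Qed.

Lemma Lpnorm_oo_le (R : realType) d U (h : 'rV[R]_d -> R[i]) (M : R) :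
  0 <= M -> (forall x, ComplexField.Normc.normc (h x) <= M) ->
  (Lpnorm +oo U h <= M%:E)%E.
Proof.
move=> M0 hM; rewrite /Lpnorm unlock; case: ifPn => _; last by rewrite lee_fin.
apply/ess_supP; apply: nearW => t /=; rewrite /patch; case: ifPn => _.
  by rewrite abse_EFin lee_fin ger0_norm// (le_trans _ (Re_le_normc _)).
by rewrite abse0 lee_fin.
Qed.

Theorem theorem1p3 (R : realType) (d : nat) (hd : (2 <= d)%N) :
  exists k : nat,
  forall (D : set 'rV[R]_d) (A : 'rV[R]_d -> 'M[R]_d) (g : 'rV[R]_d -> R[i]),
  diophantine_polygonal_domain D ->
  uniformly_elliptic A ->
  (forall i j, Ck k setT (fun x => A x i j)) ->
  Zperiodic g ->
  ReIm (Ck k setT) g ->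
  let gbar := cintegral_rV unit_cell g in
  exists eps0 : R, 0 < eps0 /\
  forall p : R, 1 <= p ->
  exists C : R, 0 < C /\
  forall (eps : R) (u_eps u0 : 'rV[R]_d -> R[i]),
  0 < eps -> eps < eps0 ->
  dirichlet_solution A D (fun x => g (eps^-1 *: x)) u_eps ->
  dirichlet_solution A D (fun=> gbar) u0 ->
  ((C * eps `^ p^-1)%:E * Lpnorm +oo unit_cell (fun x => g x - gbar)%R
     <= Lpnorm p%:E D (fun x => u_eps x - u0 x)%R)%E.
Proof.
exists 1%N; case: d hd => // d' hd D A g HD ellA A1 pg [Cr Ci] gbar.
have oD : open D.
  by case: HD => N [nu [c [_ _ -> _ _]]]; exact: polygon_open.
have cr := Ck_continuous Cr; have ci := Ck_continuous Ci.
have [Mr Mr0 grM] : exists2 M : R, 0 <= M & forall x, `|complex.Re (g x)| <= M.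
  by apply: periodic_bounded cr => x m; rewrite pg.
have [Mi Mi0 giM] : exists2 M : R, 0 <= M & forall x, `|complex.Im (g x)| <= M.
  by apply: periodic_bounded ci => x m; rewrite pg.
pose M := (Mr + `|complex.Re gbar|) + (Mi + `|complex.Im gbar|).
have M0 : 0 <= M by rewrite !addr_ge0.
have gM x : ComplexField.Normc.normc (g x - gbar) <= M.
  rewrite (le_trans (normc_le_add _))// !raddfB /M lerD//.
    by rewrite (le_trans (ler_normB _ _))// lerD2r; exact: grM.
  by rewrite (le_trans (ler_normB _ _))// lerD2r; exact: giM.
have [gcst|] := pselect (forall x, g x = gbar).
  exists 1; split => // p p1; exists 1; split => // eps u_eps u0 eps0 _ _ _.
  apply: le_trans (Lnorm_ge0 _ _ _); rewrite mule_ge0_le0//.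
    by rewrite lee_fin mulr_ge0// powR_ge0.
  apply: Lpnorm_oo_le => // x.
  by rewrite gcst subrr /= expr0n addr0 sqrtr0.
move=> /existsNP[y gy].
pose comp (s : R) (part : R[i] -> R) x := s * part (g x) + - s * part gbar.
suff [s [part [s1 cpart partB part_le [part_sol fy]]]] :
    exists (s : R) (part : R[i] -> R), [/\ `|s| = 1,
      continuous (fun x => part (g x)),
      forall w1 w2, part (w1 - w2) = part w1 - part w2,
      forall w, `|part w| <= ComplexField.Normc.normc w &
      (forall phi u, dirichlet_solution A D phi u ->
        nondiv_solution A D (fun x => part (phi x)) (fun x => part (u x))) /\
      0 < comp s part y].
  have pf : periodic (comp s part) by move=> x m; rewrite /comp pg.
  have cf : continuous (comp s part).
    by move=> x; apply: (cvgD (cvgMl_tmp (cpart x)) (cvg_cst _)).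
  have [eps1 [c0 [delta [eps10 c00 delta0 HE]]]] := boundary_layer hd HD ellA A1 pf cf fy.
  exists eps1; split => // p p1; exists (delta * c0 `^ p^-1 / (M + 1)).
  have M10 : 0 < M + 1 by rewrite ltr_wpDl.
  split; first by rewrite divr_gt0// mulr_gt0// powR_gt0.
  move=> eps u_eps u0 eps0 epslt /part_sol sol_eps /part_sol sol0.
  have [|E [mE muE EP]] := HE eps _ _ (nondiv_solution_lin s (- s) sol_eps sol0).
    by rewrite eps0.
  have ceps0 : 0 <= c0 * eps by rewrite mulr_ge0// ltW.
  have le1 : ((delta * (c0 * eps) `^ p^-1)%:E <= Lpnorm p%:E D (fun x => u_eps x - u0 x)%R)%E.
    apply: Lnorm_ge mE (ltW delta0) p1 ceps0 muE _ => t /EP[Dt dt].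
    rewrite /patch mem_set// lee_fin (le_trans dt)//.
    rewrite mulNr -mulrBr -partB (le_trans (ler_norm _))// normrM s1 mul1r.
    exact: part_le.
  apply: le_trans le1.
  have C0 : 0 <= delta * c0 `^ p^-1 / (M + 1) * eps `^ p^-1.
    by rewrite !mulr_ge0 ?powR_ge0 ?invr_ge0// ltW.
  apply: le_trans (lee_wpmul2l _ (Lpnorm_oo_le unit_cell M0 gM)) _; first by rewrite lee_fin.
  rewrite -EFinM lee_fin (powRM _ (ltW c00) (ltW eps0)) mulrA.
  have -> : delta * c0 `^ p^-1 / (M + 1) * eps `^ p^-1 * M =
    delta * c0 `^ p^-1 * eps `^ p^-1 * (M / (M + 1)) by ring.
  rewrite ler_piMr//; first by rewrite !mulr_ge0 ?powR_ge0// ltW.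
  by rewrite ler_pdivrMr// mul1r lerDl.
have solR phi u H := proj1 (dirichlet_nondiv (phi := phi) (u := u) oD A1 H).
have solI phi u H := proj2 (dirichlet_nondiv (phi := phi) (u := u) oD A1 H).
have gReIm : (complex.Re (g y) != complex.Re gbar) || (complex.Im (g y) != complex.Im gbar).
  by rewrite -negb_and -eq_complex; apply/eqP.
case/orP: gReIm; rewrite neq_lt => /orP[h|h].
- exists (-1), (@complex.Re R); rewrite normrN1; split => //; first exact: raddfB.
    exact: Re_le_normc.
  by split; [exact: solR|rewrite /comp; lra].
- exists 1, (@complex.Re R); rewrite normr1; split => //; first exact: raddfB.
    exact: Re_le_normc.
  by split; [exact: solR|rewrite /comp; lra].
- exists (-1), (@complex.Im R); rewrite normrN1; split => //; first exact: raddfB.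
    exact: Im_le_normc.
  by split; [exact: solI|rewrite /comp; lra].
- exists 1, (@complex.Im R); rewrite normr1; split => //; first exact: raddfB.
    exact: Im_le_normc.
  by split; [exact: solI|rewrite /comp; lra].
Qed.
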